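(* The algebra $\mathcal A[S^4_q]$ is the algebra of coinvariants under the coaction $\delta_R:\mathcal A[S^7_q]\to\mathcal A[S^7_q]\otimes\mathcal A[\mathrm{SU}_q(2)]$, $\delta_R(\mathsf u_i{}^j)=\sum_{\mu=1}^2\mathsf u_i{}^\mu\otimes\mathrm a_\mu{}^j$; that is, $\mathcal A[S^4_q]=\{x\in\mathcal A[S^7_q]\mid\delta_R(x)=x\otimes1\}$.
   Context: $0<q<1$ is real, $\zeta=q^{-1/2}$; algebras are unital over $\mathbb C$. $\mathcal A[\mathrm{SU}_q(2)]$ is the Hopf $*$-algebra generated by the entries of $(\mathrm a_i{}^j)=\begin{pmatrix}a&b\\ c&d\end{pmatrix}$ with $ab=qba$, $ac=qca$, $bd=qdb$, $cd=qdc$, $bc=cb$, $ad-da=(q-q^{-1})bc$, $ad-qbc=1$, $a^*=d$, $b^*=-qc$, $c^*=-q^{-1}b$, $d^*=a$, coproduct $\Delta(\mathrm a_i{}^j)=\sum_\mu\mathrm a_i{}^\mu\otimes\mathrm a_\mu{}^j$. $\mathcal A[\mathbb H^2_q]$ is the unital $*$-algebra generated by $z_1,\dots,z_4$ with the following relations and their $*$-conjugates: for $(y,w)=(z_1,z_2)$ and for $(y,w)=(z_3,z_4)$: $yw=q^{-1}wy$, $yw^*=qw^*y$, $yy^*=y^*y$, $w^*w-ww^*=(1-q^{-2})yy^*$; and $z_1z_3=\zeta qz_3z_1$, $z_1^*z_3=\zeta z_3z_1^*$, $z_2z_3=\zeta qz_3z_2$, $z_2^*z_3=\zeta z_3z_2^*$,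 $z_4z_1=\zeta qz_1z_4$, $z_1z_4^*-(q-q^{-1})z_2^*z_3=\zeta z_4^*z_1$, $z_4z_2=\zeta qz_2z_4$, $z_2z_4^*+(1-q^{-2})z_1^*z_3=\zeta z_4^*z_2$. $\mathcal A[S^7_q]$ is its quotient by the ideal generated by $r^2-1$, where $r^2=q^{-2}z_1z_1^*+z_2^*z_2+q^{-2}z_3z_3^*+z_4^*z_4$ is central. Put $\mathsf u=(\mathsf u_i{}^j)_{i=1..4,\,j=1,2}=\begin{pmatrix}q^{-1}z_1&-z_2^*\\ z_2&z_1^*\\ q^{-1}z_3&-z_4^*\\ z_4&z_3^*\end{pmatrix}$. Then $\mathsf u^*\mathsf u=1_2$ and $\mathsf p=\mathsf u\mathsf u^*\in M_4(\mathcal A[S^7_q])$ is a projection. $\mathcal A[S^4_q]$ is the $*$-subalgebra of $\mathcal A[S^7_q]$ generated by the entries of $\mathsf p$, equivalently by $x_0=2\mathsf p_{11}-1$ (central, self-adjoint), $x_1=2\mathsf p_{13}$, $x_2=2\mathsf p_{14}$ and their adjoints. The map $\delta_R$ is extended as a $*$-algebra map. *)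

(* Defs.v *)
From HB Require Import structures.
From mathcomp Require Import all_boot all_order all_algebra.
From mathcomp Require Import generic_quotient complex.
From mathcomp Require Import boolp classical_sets reals.
From mathcomp Require Import ring.

Set Implicit Arguments.
Unset Strict Implicit.
Unset Printing Implicit Defensive.

Import Order.TTheory GRing.Theory Num.Theory.

Declare Scope sterm_scope.
Delimit Scope sterm_scope with sterm.

Local Open Scope complex_scope.
Local Open Scope ring_scope.
Local Open Scope quotient_scope.
Local Open Scope classical_set_scope.

(* Unital *-algebras over the complex numbers R[i].  [algType] would force
   1 != 0, which is not available for an algebra given by an arbitrary
   presentation, and the library hierarchy has no structure joining
   [pzRingType] and [lmodType]; hence the scaling below. *)
HB.mixin Record isStarAlgebra (R : rcfType) A of GRing.PzRing A := {
  ascale : R[i] -> A -> A;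
  star : A -> A;
  ascaleA : forall c d x, ascale c (ascale d x) = ascale (c * d) x;
  ascale1 : left_id 1 ascale;
  ascaleDr : right_distributive ascale +%R;
  ascaleDl : forall x, {morph ascale^~ x : c d / c + d};
  ascaleAl : forall c x y, ascale c (x * y) = ascale c x * y;
  ascaleAr : forall c x y, ascale c (x * y) = x * ascale c y;
  starK : involutive star;
  starD : {morph star : x y / x + y};
  starM : forall x y, star (x * y) = star y * star x;
  starZ : forall c x, star (ascale c x) = ascale (conjc c) (star x)
}.

#[short(type="starAlgType")]
HB.structure Definition StarAlgebra (R : rcfType) :=
  {A of GRing.PzRing A & isStarAlgebra R A}.

Notation "c ** x" := (ascale c x) (at level 40, left associativity) : ring_scope.
Notation "x ^†" := (star x) (at level 1, format "x ^†") : ring_scope.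

Record star_hom (R : rcfType) (A B : starAlgType R) (f : A -> B) : Prop := {
  star_homL : forall (c : R[i]) (x y : A), f (c ** x + y) = c ** f x + f y;
  star_homM : GRing.monoid_morphism f;
  star_homS : {morph f : x / x^†}
}.

Record star_subalg (R : rcfType) (A : starAlgType R) (S : set A) : Prop := {
  star_subalg1 : S 1;
  star_subalgL : forall (c : R[i]) (x y : A), S x -> S y -> S (c ** x + y);
  star_subalgM : forall x y : A, S x -> S y -> S (x * y);
  star_subalgS : forall x : A, S x -> S (x^†)
}.

Section StarTheory.
Variables (R : rcfType) (A : starAlgType R).
Implicit Types x y : A.

Lemma star0 : (0 : A)^† = 0.
Proof. by apply: (addIr (0 : A)^†); rewrite -starD !add0r. Qed.

Lemma starN x : (- x)^† = - x^†.
Proof. by apply: (addIr x^†); rewrite -starD !addNr star0. Qed.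

Lemma ascale0 (c : R[i]) : c ** (0 : A) = 0.
Proof. by apply: (addIr (c ** (0 : A))); rewrite -ascaleDr !add0r. Qed.

Lemma ascale0l x : (0 : R[i]) ** x = 0.
Proof. by apply: (addIr ((0 : R[i]) ** x)); rewrite -ascaleDl !add0r. Qed.

Lemma ascaleN1 x : (-1 : R[i]) ** x = - x.
Proof. by apply: (addIr x); rewrite -{2}[x]ascale1 -ascaleDl !addNr ascale0l. Qed.

Lemma star1 : (1 : A)^† = 1.
Proof. by rewrite -[LHS]mulr1 -[X in _ * X]starK -starM mulr1 starK. Qed.

End StarTheory.

Section StarHomTheory.
Variables (R : rcfType) (A B : starAlgType R) (f : A -> B).
Hypothesis hom : star_hom f.

Lemma star_homD x y : f (x + y) = f x + f y.
Proof. by rewrite -[x in LHS]ascale1 (star_homL hom) ascale1. Qed.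

Lemma star_hom0 : f 0 = 0.
Proof. by apply: (addIr (f 0)); rewrite -star_homD !add0r. Qed.

Lemma star_homZ (c : R[i]) x : f (c ** x) = c ** f x.
Proof. by rewrite -[_ ** x]addr0 (star_homL hom) star_hom0 addr0. Qed.

Lemma star_homN x : f (- x) = - f x.
Proof. by rewrite -ascaleN1 star_homZ ascaleN1. Qed.

End StarHomTheory.

(* Unital *-algebras presented by generators and relations: the type of
   formal *-polynomial expressions in the generators, modulo the least
   congruence containing the axioms of unital *-algebras and the relations. *)
Inductive sterm (R : rcfType) (G : Type) :=
  | SGen of G
  | SZero
  | SOne
  | SAdd of sterm R G & sterm R G
  | SMul of sterm R G & sterm R G
  | SScale of R[i] & sterm R G
  | SStar of sterm R G.

Arguments SGen {R G}.
Arguments SZero {R G}.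
Arguments SOne {R G}.
Arguments SAdd {R G}.
Arguments SMul {R G}.
Arguments SScale {R G}.
Arguments SStar {R G}.
Bind Scope sterm_scope with sterm.

Notation "0" := SZero : sterm_scope.
Notation "1" := SOne : sterm_scope.
Notation "s + t" := (SAdd s t) : sterm_scope.
Notation "s * t" := (SMul s t) : sterm_scope.
Notation "c ** t" := (SScale c%R t) : sterm_scope.
Notation "- t" := (SScale (-1)%R t) : sterm_scope.
Notation "s - t" := (SAdd s (SScale (-1)%R t)) : sterm_scope.
Notation "t ^†" := (SStar t) : sterm_scope.

HB.instance Definition _ (R : rcfType) (G : Type) := gen_eqMixin (sterm R G).
HB.instance Definition _ (R : rcfType) (G : Type) :=
  gen_choiceMixin (sterm R G).

Section Presented.
Variables (R : rcfType) (G : Type) (rel : sterm R G -> sterm R G -> Prop).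

Inductive presented_eq : sterm R G -> sterm R G -> Prop :=
  | peq_rel s t : rel s t -> presented_eq s t
  | peq_refl s : presented_eq s s
  | peq_sym s t : presented_eq s t -> presented_eq t s
  | peq_trans s t u : presented_eq s t -> presented_eq t u -> presented_eq s u
  | peq_cadd s s' t t' : presented_eq s s' -> presented_eq t t' ->
      presented_eq (s + t) (s' + t')
  | peq_cmul s s' t t' : presented_eq s s' -> presented_eq t t' ->
      presented_eq (s * t) (s' * t')
  | peq_cscale c s s' : presented_eq s s' -> presented_eq (c ** s) (c ** s')
  | peq_cstar s s' : presented_eq s s' -> presented_eq (s^†) (s'^†)
  | peq_addA s t u : presented_eq (s + (t + u)) (s + t + u)
  | peq_addC s t : presented_eq (s + t) (t + s)
  | peq_add0 s : presented_eq (0 + s) s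
  | peq_addN s : presented_eq (- s + s) 0
  | peq_mulA s t u : presented_eq (s * (t * u)) (s * t * u)
  | peq_mul1l s : presented_eq (1 * s) s
  | peq_mul1r s : presented_eq (s * 1) s
  | peq_mulDl s t u : presented_eq ((s + t) * u) (s * u + t * u)
  | peq_mulDr s t u : presented_eq (s * (t + u)) (s * t + s * u)
  | peq_scaleA c d s : presented_eq (c ** (d ** s)) ((c * d)%R ** s)
  | peq_scale1 s : presented_eq (1%R ** s) s
  | peq_scaleDr c s t : presented_eq (c ** (s + t)) (c ** s + c ** t)
  | peq_scaleDl c d s : presented_eq ((c + d)%R ** s) (c ** s + d ** s)
  | peq_scaleAl c s t : presented_eq (c ** (s * t)) ((c ** s) * t)
  | peq_scaleAr c s t : presented_eq (c ** (s * t)) (s * (c ** t))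
  | peq_starK s : presented_eq (s^†^†) s
  | peq_starD s t : presented_eq ((s + t)^†) (s^† + t^†)
  | peq_starM s t : presented_eq ((s * t)^†) (t^† * s^†)
  | peq_starZ c s : presented_eq ((c ** s)^†) ((conjc c) ** s^†).

Definition presented_eqb s t := `[< presented_eq s t >].

Lemma presented_eqb_refl : reflexive presented_eqb.
Proof. by move=> s; apply/asboolP/peq_refl. Qed.
Lemma presented_eqb_sym : symmetric presented_eqb.
Proof. by move=> s t; apply/asboolP/asboolP; apply: peq_sym. Qed.
Lemma presented_eqb_trans : transitive presented_eqb.
Proof. by move=> s t u /asboolP ? /asboolP ?; apply/asboolP/(@peq_trans _ s). Qed.

Canonical presented_equiv :=
  EquivRel presented_eqb presented_eqb_refl presented_eqb_sym
    presented_eqb_trans.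

Definition presented := {eq_quot presented_equiv}.

HB.instance Definition _ := Choice.on presented.
HB.instance Definition _ := EqQuotient.on presented.

Lemma presentedP s t : \pi_presented s = \pi_presented t <-> presented_eq s t.
Proof.
by split=> [/eqquotP/asboolP|st]; last by apply/eqquotP/asboolP.
Qed.

(* Locked so that rewriting with [pE] does not unfold the operations. *)
Definition p_add := locked (fun x y : presented =>
  \pi_presented (SAdd (repr x) (repr y))).
Definition p_mul := locked (fun x y : presented =>
  \pi_presented (SMul (repr x) (repr y))).
Definition p_scale := locked (fun (c : R[i]) (x : presented) =>
  \pi_presented (SScale c (repr x))).
Definition p_star := locked (fun x : presented => \pi_presented (SStar (repr x))).

Let repr_eq s : presented_eq (repr (\pi_presented s)) s.
Proof. by apply/presentedP; rewrite reprK. Qed.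

Let p_addE s t : p_add (\pi_presented s) (\pi_presented t) = \pi_presented (s + t)%sterm.
Proof. by rewrite /p_add -lock; apply/presentedP/peq_cadd. Qed.
Let p_mulE s t : p_mul (\pi_presented s) (\pi_presented t) = \pi_presented (s * t)%sterm.
Proof. by rewrite /p_mul -lock; apply/presentedP/peq_cmul. Qed.
Let p_scaleE c s : p_scale c (\pi_presented s) = \pi_presented (c ** s)%sterm.
Proof. by rewrite /p_scale -lock; apply/presentedP/peq_cscale. Qed.
Let p_starE s : p_star (\pi_presented s) = \pi_presented (s^†)%sterm.
Proof. by rewrite /p_star -lock; apply/presentedP/peq_cstar. Qed.
Let pE := (p_addE, p_mulE, p_scaleE, p_starE).

Fact p_addA : associative p_add.
Proof.
elim/quotW=> s; elim/quotW=> t; elim/quotW=> u; rewrite !pE.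
by apply/presentedP; apply: peq_addA.
Qed.
Fact p_addC : commutative p_add.
Proof.
by elim/quotW=> s; elim/quotW=> t; rewrite !pE; apply/presentedP; apply: peq_addC.
Qed.
Fact p_add0 : left_id (\pi_presented SZero) p_add.
Proof. by elim/quotW=> s; rewrite !pE; apply/presentedP; apply: peq_add0. Qed.
Fact p_addN : left_inverse (\pi_presented SZero) (p_scale (-1)) p_add.
Proof. by elim/quotW=> s; rewrite !pE; apply/presentedP; apply: peq_addN. Qed.

HB.instance Definition _ :=
  GRing.isZmodule.Build presented p_addA p_addC p_add0 p_addN.

Fact p_mulA : associative p_mul.
Proof.
elim/quotW=> s; elim/quotW=> t; elim/quotW=> u; rewrite !pE.
by apply/presentedP; apply: peq_mulA.
Qed.
Fact p_mul1l : left_id (\pi_presented SOne) p_mul.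
Proof. by elim/quotW=> s; rewrite !pE; apply/presentedP; apply: peq_mul1l. Qed.
Fact p_mul1r : right_id (\pi_presented SOne) p_mul.
Proof. by elim/quotW=> s; rewrite !pE; apply/presentedP; apply: peq_mul1r. Qed.
Fact p_mulDl : left_distributive p_mul p_add.
Proof.
elim/quotW=> s; elim/quotW=> t; elim/quotW=> u; rewrite !pE.
by apply/presentedP; apply: peq_mulDl.
Qed.
Fact p_mulDr : right_distributive p_mul p_add.
Proof.
elim/quotW=> s; elim/quotW=> t; elim/quotW=> u; rewrite !pE.
by apply/presentedP; apply: peq_mulDr.
Qed.

HB.instance Definition _ := GRing.Zmodule_isPzRing.Build presented
  p_mulA p_mul1l p_mul1r p_mulDl p_mulDr.

Fact p_scaleA c d x : p_scale c (p_scale d x) = p_scale (c * d) x.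
Proof. by elim/quotW: x => s; rewrite !pE; apply/presentedP; apply: peq_scaleA. Qed.
Fact p_scale1 : left_id 1 p_scale.
Proof. by elim/quotW=> s; rewrite !pE; apply/presentedP; apply: peq_scale1. Qed.
Fact p_scaleDr : right_distributive p_scale p_add.
Proof.
move=> c; elim/quotW=> s; elim/quotW=> t; rewrite !pE.
by apply/presentedP; apply: peq_scaleDr.
Qed.
Fact p_scaleDl x : {morph p_scale^~ x : c d / c + d >-> p_add c d}.
Proof.
by elim/quotW: x => s c d; rewrite !pE; apply/presentedP; apply: peq_scaleDl.
Qed.

Fact p_scaleAl c x y : p_scale c (p_mul x y) = p_mul (p_scale c x) y.
Proof.
elim/quotW: x => s; elim/quotW: y => t; rewrite !pE.
by apply/presentedP; apply: peq_scaleAl.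
Qed.
Fact p_scaleAr c x y : p_scale c (p_mul x y) = p_mul x (p_scale c y).
Proof.
elim/quotW: x => s; elim/quotW: y => t; rewrite !pE.
by apply/presentedP; apply: peq_scaleAr.
Qed.
Fact p_starK : involutive p_star.
Proof. by elim/quotW=> s; rewrite !pE; apply/presentedP; apply: peq_starK. Qed.
Fact p_starD x y : p_star (p_add x y) = p_add (p_star x) (p_star y).
Proof.
elim/quotW: x => s; elim/quotW: y => t; rewrite !pE.
by apply/presentedP; apply: peq_starD.
Qed.
Fact p_starM x y : p_star (p_mul x y) = p_mul (p_star y) (p_star x).
Proof.
elim/quotW: x => s; elim/quotW: y => t; rewrite !pE.
by apply/presentedP; apply: peq_starM.
Qed.
Fact p_starZ c x : p_star (p_scale c x) = p_scale (conjc c) (p_star x).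
Proof. by elim/quotW: x => s; rewrite !pE; apply/presentedP; apply: peq_starZ. Qed.

HB.instance Definition _ := isStarAlgebra.Build R presented
  p_scaleA p_scale1 p_scaleDr p_scaleDl p_scaleAl p_scaleAr
  p_starK p_starD p_starM p_starZ.

Definition pgen (g : G) : presented := \pi_presented (SGen g).

Section Lift.
Variables (A : starAlgType R) (f : G -> A).

Fixpoint seval (t : sterm R G) : A :=
  match t with
  | SGen g => f g
  | SZero => 0
  | SOne => 1
  | SAdd s t => seval s + seval t
  | SMul s t => seval s * seval t
  | SScale c t => c ** seval t
  | SStar t => (seval t)^†
  end.

(* Only meaningful when [f] satisfies the relations; see [plift_star_hom]. *)
Definition plift (x : presented) : A := seval (repr x).

Hypothesis f_rel : forall s t, rel s t -> seval s = seval t.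

Lemma seval_eq s t : presented_eq s t -> seval s = seval t.
Proof.
elim=> //=.
- by move=> s1 s2 s3 _ -> _ ->.
- by move=> s1 s2 t1 t2 _ -> _ ->.
- by move=> s1 s2 t1 t2 _ -> _ ->.
- by move=> c s1 s2 _ ->.
- by move=> s1 s2 _ ->.
- by move=> s1 s2 s3; rewrite addrA.
- by move=> s1 s2; rewrite addrC.
- by move=> s1; rewrite add0r.
- by move=> s1; rewrite ascaleN1 addNr.
- by move=> s1 s2 s3; rewrite mulrA.
- by move=> s1; rewrite mul1r.
- by move=> s1; rewrite mulr1.
- by move=> s1 s2 s3; rewrite mulrDl.
- by move=> s1 s2 s3; rewrite mulrDr.
- by move=> c d s1; rewrite ascaleA.
- by move=> s1; rewrite ascale1.
- by move=> c s1 s2; rewrite ascaleDr.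
- by move=> c d s1; rewrite ascaleDl.
- by move=> c s1 s2; rewrite ascaleAl.
- by move=> c s1 s2; rewrite ascaleAr.
- by move=> s1; rewrite starK.
- by move=> s1 s2; rewrite starD.
- by move=> s1 s2; rewrite starM.
- by move=> c s1; rewrite starZ.
Qed.

Lemma plift_pi s : plift (\pi_presented s) = seval s.
Proof. exact/seval_eq/repr_eq. Qed.

Lemma plift_gen g : plift (pgen g) = f g.
Proof. exact: plift_pi. Qed.

Lemma plift_star_hom : star_hom plift.
Proof.
split.
- move=> c; elim/quotW=> s; elim/quotW=> t.
  rewrite [_ + _](_ : _ = \pi_presented (c ** s + t)%sterm) ?plift_pi //.
  by rewrite -p_addE -p_scaleE.
- split=> [|]; first by rewrite plift_pi.
  elim/quotW=> s; elim/quotW=> t.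
  by rewrite [_ * _]p_mulE !plift_pi.
- by elim/quotW=> s; rewrite [_^†]p_starE !plift_pi.
Qed.

End Lift.

Lemma seval_pgen s : seval pgen s = \pi_presented s.
Proof.
elim: s => //=.
- by move=> s -> t ->; rewrite [LHS]p_addE.
- by move=> s -> t ->; rewrite [LHS]p_mulE.
- by move=> c s ->; rewrite [LHS]p_scaleE.
- by move=> s ->; rewrite [LHS]p_starE.
Qed.

Lemma pgen_rel s t : rel s t -> seval pgen s = seval pgen t.
Proof. by move=> st; rewrite !seval_pgen; apply/presentedP/peq_rel. Qed.

End Presented.

(* The algebraic tensor product over the complex numbers: formal finite sums
   of pairs modulo the least congruence making (a, b) |-> a (x) b bilinear. *)
Section Tensor.
Variables (R : rcfType) (A B : starAlgType R).
Implicit Types s t u : seq (A * B).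

Inductive tens_eq : seq (A * B) -> seq (A * B) -> Prop :=
  | teq_refl s : tens_eq s s
  | teq_sym s t : tens_eq s t -> tens_eq t s
  | teq_trans s t u : tens_eq s t -> tens_eq t u -> tens_eq s u
  | teq_cat s s' t t' : tens_eq s s' -> tens_eq t t' ->
      tens_eq (s ++ t) (s' ++ t')
  | teq_catC s t : tens_eq (s ++ t) (t ++ s)
  | teq_0l b : tens_eq [:: (0, b)] [::]
  | teq_Dl a a' b : tens_eq [:: (a + a', b)] [:: (a, b); (a', b)]
  | teq_Dr a b b' : tens_eq [:: (a, b + b')] [:: (a, b); (a, b')]
  | teq_Z c a b : tens_eq [:: (c ** a, b)] [:: (a, c ** b)].

Definition tens_eqb s t := `[< tens_eq s t >].

Lemma tens_eqb_refl : reflexive tens_eqb.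
Proof. by move=> s; apply/asboolP/teq_refl. Qed.
Lemma tens_eqb_sym : symmetric tens_eqb.
Proof. by move=> s t; apply/asboolP/asboolP; apply: teq_sym. Qed.
Lemma tens_eqb_trans : transitive tens_eqb.
Proof. by move=> s t u /asboolP ? /asboolP ?; apply/asboolP/(@teq_trans _ s). Qed.

Canonical tens_equiv :=
  EquivRel tens_eqb tens_eqb_refl tens_eqb_sym tens_eqb_trans.

Definition tensor := {eq_quot tens_equiv}.

HB.instance Definition _ := Choice.on tensor.
HB.instance Definition _ := EqQuotient.on tensor.

Lemma tensorP s t : \pi_tensor s = \pi_tensor t <-> tens_eq s t.
Proof. by split=> [/eqquotP/asboolP|st]; last by apply/eqquotP/asboolP. Qed.

Let mul_pre s t := [seq (x.1 * y.1, x.2 * y.2) | x <- s, y <- t].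
Let scale_pre (c : R[i]) s := [seq (c ** x.1, x.2) | x <- s].
Let star_pre s := [seq (x.1^†, x.2^†) | x <- s].

Let teq_perm s t : perm_eq s t -> tens_eq s t.
Proof.
elim: s t => [|x s IHs] t; first by move/perm_size/esym/size0nil => ->; apply: teq_refl.
move=> st; have xt : x \in t by rewrite -(perm_mem st) mem_head.
case/splitPr: t / xt st => t1 t2 st.
have {}st : perm_eq s (t2 ++ t1).
  by rewrite -(perm_cons x) (perm_trans st) // perm_catC.
apply: (@teq_trans _ ([:: x] ++ (t2 ++ t1))).
  by rewrite -cat1s; apply: teq_cat; [exact: teq_refl | exact: IHs].
exact: (teq_catC (x :: t2) t1).
Qed.

Let tens_eq_map (f : A * B -> seq (A * B)) s t :
  (forall b, tens_eq (f (0, b)) [::]) ->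
  (forall a a' b, tens_eq (f (a + a', b)) (f (a, b) ++ f (a', b))) ->
  (forall a b b', tens_eq (f (a, b + b')) (f (a, b) ++ f (a, b'))) ->
  (forall c a b, tens_eq (f (c ** a, b)) (f (a, c ** b))) ->
  tens_eq s t -> tens_eq (flatten (map f s)) (flatten (map f t)).
Proof.
move=> f0 fDl fDr fZ; elim=> {s t} //=.
- by move=> s; apply: teq_refl.
- by move=> s t _; apply: teq_sym.
- by move=> s t u _ ? _; apply: teq_trans.
- by move=> s s' t t' _ ? _ ?; rewrite !map_cat !flatten_cat; apply: teq_cat.
- by move=> s t; rewrite !map_cat !flatten_cat; apply: teq_catC.
- by move=> b; rewrite cats0.
- by move=> a a' b; rewrite !cats0.
- by move=> a b b'; rewrite !cats0.
- by move=> c a b; rewrite !cats0.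
Qed.

Let flat1 (f : A * B -> A * B) s : flatten [seq [:: f x] | x <- s] = map f s.
Proof. by elim: s => //= x s ->. Qed.

Let scale_cong c s t : tens_eq s t -> tens_eq (scale_pre c s) (scale_pre c t).
Proof.
move=> st; rewrite /scale_pre -!flat1; apply: tens_eq_map st => //=.
- by move=> b; rewrite ascale0; apply: teq_0l.
- by move=> a a' b; rewrite ascaleDr; apply: teq_Dl.
- by move=> a b b'; apply: teq_Dr.
- by move=> d a b; rewrite ascaleA mulrC -ascaleA; apply: teq_Z.
Qed.

Let star_cong s t : tens_eq s t -> tens_eq (star_pre s) (star_pre t).
Proof.
move=> st; rewrite /star_pre -!flat1; apply: tens_eq_map st => //=.
- by move=> b; rewrite star0; apply: teq_0l.
- by move=> a a' b; rewrite starD; apply: teq_Dl.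
- by move=> a b b'; rewrite starD; apply: teq_Dr.
- by move=> d a b; rewrite !starZ; apply: teq_Z.
Qed.

Let mul_cong1 x s t : tens_eq s t -> tens_eq (mul_pre [:: x] s) (mul_pre [:: x] t).
Proof.
rewrite /mul_pre /= !cats0 => st; rewrite -!flat1.
apply: tens_eq_map st => //=.
- by move=> b; rewrite mulr0; apply: teq_0l.
- by move=> a a' b; rewrite mulrDr; apply: teq_Dl.
- by move=> a b b'; rewrite mulrDr; apply: teq_Dr.
- by move=> d a b; rewrite -ascaleAr -ascaleAr; apply: teq_Z.
Qed.

Let mul_cons x s t : mul_pre (x :: s) t = mul_pre [:: x] t ++ mul_pre s t.
Proof. by rewrite /mul_pre /= cats0. Qed.

Let mul_congr s t t' : tens_eq t t' -> tens_eq (mul_pre s t) (mul_pre s t').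
Proof.
move=> tt'; elim: s => [|x s IHs]; first exact: teq_refl.
by rewrite (mul_cons x s t) (mul_cons x s t'); apply: teq_cat => //; apply: mul_cong1.
Qed.

Let mul_congl s s' t : tens_eq s s' -> tens_eq (mul_pre s t) (mul_pre s' t).
Proof.
move=> ss'; rewrite /mul_pre /allpairs; apply: (tens_eq_map _ _ _ _ ss') => /=.
- move=> b; elim: t => [|y t IHt] /=; first exact: teq_refl.
  rewrite mul0r -(cat1s _ (map _ _)) -[X in tens_eq _ X]cats0.
  by apply: teq_cat IHt; apply: teq_0l.
- move=> a a' b; elim: t => [|y t IHt] /=; first exact: teq_refl.
  rewrite mulrDl; apply: (@teq_trans _ _ _ (teq_cat (teq_Dl _ _ _) IHt)).
  apply: teq_perm => /=; rewrite perm_cons perm_sym -cat_rcons -cats1 -catA.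
  by rewrite perm_catCA.
- move=> a b b'; elim: t => [|y t IHt] /=; first exact: teq_refl.
  rewrite mulrDl; apply: (@teq_trans _ _ _ (teq_cat (teq_Dr _ _ _) IHt)).
  apply: teq_perm => /=; rewrite perm_cons perm_sym -cat_rcons -cats1 -catA.
  by rewrite perm_catCA.
- move=> c a b; elim: t => [|y t IHt] /=; first exact: teq_refl.
  by rewrite -!ascaleAl; apply: teq_cat (teq_Z _ _ _) IHt.
Qed.

Definition t_add := locked (fun x y : tensor =>
  \pi_tensor (repr x ++ repr y)).
Definition t_mul := locked (fun x y : tensor =>
  \pi_tensor (mul_pre (repr x) (repr y))).
Definition t_scale := locked (fun (c : R[i]) (x : tensor) =>
  \pi_tensor (scale_pre c (repr x))).
Definition t_star := locked (fun x : tensor => \pi_tensor (star_pre (repr x))).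

Let repr_teq s : tens_eq (repr (\pi_tensor s)) s.
Proof. by apply/tensorP; rewrite reprK. Qed.

Let t_addE s t : t_add (\pi_tensor s) (\pi_tensor t) = \pi_tensor (s ++ t).
Proof. by rewrite /t_add -lock; apply/tensorP/teq_cat. Qed.
Let t_mulE s t : t_mul (\pi_tensor s) (\pi_tensor t) = \pi_tensor (mul_pre s t).
Proof.
by rewrite /t_mul -lock; apply/tensorP; apply: (teq_trans (mul_congl _ (repr_teq s)));
   apply: mul_congr.
Qed.
Let t_scaleE c s : t_scale c (\pi_tensor s) = \pi_tensor (scale_pre c s).
Proof. by rewrite /t_scale -lock; apply/tensorP/scale_cong. Qed.
Let t_starE s : t_star (\pi_tensor s) = \pi_tensor (star_pre s).
Proof. by rewrite /t_star -lock; apply/tensorP/star_cong. Qed.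
Let tE := (t_addE, t_mulE, t_scaleE, t_starE).

Fact t_addA : associative t_add.
Proof. by elim/quotW=> s; elim/quotW=> t; elim/quotW=> u; rewrite !tE catA. Qed.
Fact t_addC : commutative t_add.
Proof.
by elim/quotW=> s; elim/quotW=> t; rewrite !tE; apply/tensorP; apply: teq_catC.
Qed.
Fact t_add0 : left_id (\pi_tensor [::]) t_add.
Proof. by elim/quotW=> s; rewrite !tE. Qed.
Fact t_addN : left_inverse (\pi_tensor [::]) (t_scale (-1)) t_add.
Proof.
elim/quotW=> s; rewrite !tE; apply/tensorP.
elim: s => [|[a b] s IHs] /=; first exact: teq_refl.
apply: (@teq_trans _ ([:: (-1 ** a, b); (a, b)] ++ (scale_pre (-1) s ++ s))).
  by apply: teq_perm => /=; rewrite perm_cons -cat1s perm_catCA.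
apply: (teq_trans (teq_cat (teq_refl _) IHs)); rewrite cats0.
apply: (teq_trans (teq_sym (teq_Dl _ _ _))).
by rewrite ascaleN1 addNr; apply: teq_0l.
Qed.

HB.instance Definition _ :=
  GRing.isZmodule.Build tensor t_addA t_addC t_add0 t_addN.

Definition tens (a : A) (b : B) : tensor := \pi_tensor [:: (a, b)].

Lemma tensDl a a' b : tens (a + a') b = tens a b + tens a' b.
Proof. by rewrite [RHS]t_addE; apply/tensorP/teq_Dl. Qed.
Lemma tensDr a b b' : tens a (b + b') = tens a b + tens a b'.
Proof. by rewrite [RHS]t_addE; apply/tensorP/teq_Dr. Qed.

Lemma tensor_sum s : \pi_tensor s = \sum_(x <- s) tens x.1 x.2.
Proof.
elim: s => [|[a b] s IHs]; first by rewrite big_nil.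
by rewrite big_cons -IHs [RHS]t_addE.
Qed.

Lemma tensor_ind (P : tensor -> Prop) :
  P 0 -> (forall a b x, P x -> P (tens a b + x)) -> forall x, P x.
Proof.
move=> P0 PD; elim/quotW=> s; rewrite tensor_sum.
by elim: s => [|[a b] s IHs]; rewrite ?big_nil // big_cons; apply: PD.
Qed.

Let mul_tens a b a' b' : t_mul (tens a b) (tens a' b') = tens (a * a') (b * b').
Proof. by rewrite [LHS]t_mulE. Qed.

Fact t_mulDl : left_distributive t_mul t_add.
Proof.
elim/quotW=> s; elim/quotW=> t; elim/quotW=> u; rewrite !tE.
by rewrite /mul_pre allpairs_cat.
Qed.
Fact t_mulDr : right_distributive t_mul t_add.
Proof.
elim/quotW=> s; elim/quotW=> t; elim/quotW=> u; rewrite !tE.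
by apply/tensorP/teq_perm; rewrite /mul_pre perm_allpairs_catr.
Qed.

Let t_mul0l x : t_mul 0 x = 0.
Proof. by elim/quotW: x => s; rewrite [LHS]t_mulE. Qed.
Let t_mul0r x : t_mul x 0 = 0.
Proof.
elim/quotW: x => s; rewrite [LHS]t_mulE; congr \pi.
by elim: s => //= x s; rewrite /mul_pre.
Qed.

Fact t_mulA : associative t_mul.
Proof.
elim/tensor_ind=> [y z|a b x IHx y z]; first by rewrite !t_mul0l.
rewrite !t_mulDl IHx; congr (_ + _); elim/tensor_ind: y z {IHx}.
  by move=> z; rewrite !(t_mul0l, t_mul0r).
move=> a' b' y IHy z; rewrite !(t_mulDl, t_mulDr) IHy; congr (_ + _).
elim/tensor_ind: z {IHy} => [|a'' b'' z IHz]; first by rewrite !t_mul0r.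
by rewrite !t_mulDr IHz !mul_tens !mulrA.
Qed.
Fact t_mul1l : left_id (tens 1 1) t_mul.
Proof.
elim/tensor_ind=> [|a b x IHx]; first exact: t_mul0r.
by rewrite t_mulDr IHx mul_tens !mul1r.
Qed.
Fact t_mul1r : right_id (tens 1 1) t_mul.
Proof.
elim/tensor_ind=> [|a b x IHx]; first exact: t_mul0l.
by rewrite t_mulDl IHx mul_tens !mulr1.
Qed.

HB.instance Definition _ := GRing.Zmodule_isPzRing.Build tensor
  t_mulA t_mul1l t_mul1r t_mulDl t_mulDr.

Lemma tensM a b a' b' : tens a b * tens a' b' = tens (a * a') (b * b').
Proof. exact: mul_tens. Qed.

Let scale_tens c a b : t_scale c (tens a b) = tens (c ** a) b.
Proof. by rewrite [LHS]t_scaleE. Qed.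
Fact t_scaleDr : right_distributive t_scale t_add.
Proof.
by move=> c; elim/quotW=> s; elim/quotW=> t; rewrite !tE /scale_pre map_cat.
Qed.
Let t_scale0 c : t_scale c 0 = 0.
Proof. by rewrite [LHS]t_scaleE. Qed.

Fact t_scaleA c d x : t_scale c (t_scale d x) = t_scale (c * d) x.
Proof.
elim/tensor_ind: x => [|a b x IHx]; first by rewrite !t_scale0.
by rewrite !t_scaleDr IHx !scale_tens ascaleA.
Qed.
Fact t_scale1 : left_id 1 t_scale.
Proof.
elim/tensor_ind=> [|a b x IHx]; first by rewrite t_scale0.
by rewrite t_scaleDr IHx scale_tens ascale1.
Qed.
Fact t_scaleDl x : {morph t_scale^~ x : c d / c + d >-> t_add c d}.
Proof.
move=> c d; elim/tensor_ind: x => [|a b x IHx].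
  by rewrite !t_scale0 t_add0.
rewrite !t_scaleDr IHx !scale_tens ascaleDl tensDl.
by rewrite [LHS]addrACA.
Qed.

Fact t_scaleAl c (x y : tensor) : t_scale c (x * y) = t_scale c x * y.
Proof.
elim/tensor_ind: x => [|a b x IHx]; first by rewrite mul0r !t_scale0 mul0r.
rewrite mulrDl !t_scaleDr mulrDl IHx; congr (_ + _).
elim/tensor_ind: y {IHx} => [|a' b' y IHy]; first by rewrite !mulr0 t_scale0.
by rewrite !mulrDr t_scaleDr IHy !(scale_tens, tensM) ascaleAl.
Qed.
Fact t_scaleAr c (x y : tensor) : t_scale c (x * y) = x * t_scale c y.
Proof.
elim/tensor_ind: x => [|a b x IHx]; first by rewrite !mul0r t_scale0.
rewrite !mulrDl t_scaleDr IHx; congr (_ + _).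
elim/tensor_ind: y {IHx} => [|a' b' y IHy]; first by rewrite mulr0 !t_scale0 mulr0.
by rewrite mulrDr !t_scaleDr mulrDr IHy !(scale_tens, tensM) ascaleAr.
Qed.

Let star_tens a b : t_star (tens a b) = tens (a^†) (b^†).
Proof. by rewrite [LHS]t_starE. Qed.
Fact t_starD (x y : tensor) : t_star (x + y) = t_star x + t_star y.
Proof.
elim/quotW: x => s; elim/quotW: y => t.
by rewrite [_ + _]t_addE !t_starE [RHS]t_addE /star_pre map_cat.
Qed.
Let t_star0 : t_star 0 = 0.
Proof. by rewrite [LHS]t_starE. Qed.
Fact t_starK : involutive t_star.
Proof.
elim/tensor_ind=> [|a b x IHx]; first by rewrite !t_star0.
by rewrite !t_starD IHx !star_tens !starK.
Qed.
Fact t_starM (x y : tensor) : t_star (x * y) = t_star y * t_star x.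
Proof.
elim/tensor_ind: x => [|a b x IHx]; first by rewrite mul0r !t_star0 mulr0.
rewrite mulrDl !t_starD mulrDr IHx; congr (_ + _).
elim/tensor_ind: y {IHx} => [|a' b' y IHy]; first by rewrite mulr0 !t_star0 mul0r.
by rewrite mulrDr !t_starD mulrDl IHy tensM !star_tens tensM !starM.
Qed.
Fact t_starZ c (x : tensor) :
  t_star (t_scale c x) = t_scale (conjc c) (t_star x).
Proof.
elim/tensor_ind: x => [|a b x IHx]; first by rewrite t_scale0 !t_star0 t_scale0.
by rewrite t_scaleDr !t_starD t_scaleDr IHx !(scale_tens, star_tens) starZ.
Qed.

HB.instance Definition _ := isStarAlgebra.Build R tensor
  t_scaleA t_scale1 t_scaleDr t_scaleDl t_scaleAl t_scaleAr
  t_starK t_starD t_starM t_starZ.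

Lemma tensZl c a b : tens (c ** a) b = c ** tens a b.
Proof. by rewrite [RHS]scale_tens. Qed.
Lemma tensZr c a b : tens a (c ** b) = c ** tens a b.
Proof. by rewrite -tensZl; apply/tensorP/teq_sym/teq_Z. Qed.

Lemma tensS a b : (tens a b)^† = tens (a^†) (b^†).
Proof. exact: star_tens. Qed.

End Tensor.

Notation "a ⊗ b" := (tens a b) (at level 40, left associativity) : ring_scope.

(* [lin_solve] reduces an equality of linear combinations to the equalities of
   the coefficients. *)
Section LinearReflection.
Variables (R : rcfType) (A : starAlgType R).

Inductive lexp :=
  | LAtom of nat
  | LAdd of lexp & lexp
  | LOpp of lexp
  | LScale of R[i] & lexp.

Fixpoint leval (env : seq A) e : A :=
  match e with
  | LAtom i => env`_i
  | LAdd e1 e2 => leval env e1 + leval env e2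
  | LOpp e1 => - leval env e1
  | LScale c e1 => c ** leval env e1
  end.

Fixpoint lcoef e (i : nat) : R[i] :=
  match e with
  | LAtom j => if i == j then 1 else 0
  | LAdd e1 e2 => lcoef e1 i + lcoef e2 i
  | LOpp e1 => - lcoef e1 i
  | LScale c e1 => c * lcoef e1 i
  end.

Lemma leval_coef env e :
  leval env e = \sum_(i < size env) lcoef e i ** env`_i.
Proof.
elim: e => [j|e1 IH1 e2 IH2|e1 IH1|c e1 IH1] /=.
- have [jn|nj] := ltnP j (size env).
    rewrite (bigD1 (Ordinal jn)) //= eqxx ascale1 big1 ?addr0 // => i.
    by rewrite -val_eqE /= => /negbTE ->; rewrite ascale0l.
  rewrite nth_default // big1 // => i _.
  by rewrite (ltn_eqF (leq_trans (ltn_ord i) nj)) ascale0l.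
- rewrite IH1 IH2 -big_split; apply: eq_bigr => i _.
  by rewrite /= ascaleDl.
- rewrite IH1 -sumrN; apply: eq_bigr => i _.
  by rewrite /= -[in RHS]mulN1r -ascaleA ascaleN1.
- rewrite IH1 (big_morph _ (ascaleDr c) (ascale0 A c)); apply: eq_bigr => i _.
  by rewrite ascaleA.
Qed.

Fixpoint ltest e1 e2 n :=
  if n is n'.+1 then (lcoef e1 n' = lcoef e2 n') /\ ltest e1 e2 n' else True.

Lemma lin_reflect env e1 e2 :
  ltest e1 e2 (size env) -> leval env e1 = leval env e2.
Proof.
move=> h; rewrite !leval_coef; apply: eq_bigr => -[i /= lt_i] _; congr (_ ** _).
elim: (size env) lt_i h => // n IHn; rewrite ltnS leq_eqVlt => /orP[/eqP->|].
  by case.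
by move=> lt_i [_ /(IHn lt_i)].
Qed.

End LinearReflection.

Ltac lin_mem x l :=
  lazymatch l with
  | cons x _ => constr:(true)
  | cons _ ?l' => lin_mem x l'
  | nil => constr:(false)
  end.
Ltac lin_atoms e env :=
  lazymatch e with
  | @GRing.add _ ?x ?y => let env := lin_atoms x env in lin_atoms y env
  | @GRing.opp _ ?x => lin_atoms x env
  | @ascale _ _ _ ?x => lin_atoms x env
  | ?x => lazymatch lin_mem x env with
          | true => env | false => constr:(cons x env) end
  end.
Ltac lin_index x l :=
  lazymatch l with
  | cons x _ => constr:(O)
  | cons _ ?l' => let n := lin_index x l' in constr:(S n)
  end.
Ltac lin_quote R e env :=
  lazymatch e with
  | @GRing.add _ ?x ?y =>
      let x := lin_quote R x env in let y := lin_quote R y env in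
      constr:(@LAdd R x y)
  | @GRing.opp _ ?x => let x := lin_quote R x env in constr:(@LOpp R x)
  | @ascale _ _ ?c ?x => let x := lin_quote R x env in constr:(@LScale R c x)
  | ?x => let n := lin_index x env in constr:(@LAtom R n)
  end.
Ltac lin_solve R A :=
  lazymatch goal with
  | |- ?e1 = ?e2 =>
      let env := lin_atoms e1 (@nil (StarAlgebra.sort A)) in
      let env := lin_atoms e2 env in
      let e1 := lin_quote R e1 env in
      let e2 := lin_quote R e2 env in
      apply: (@lin_reflect R A env e1 e2); 
      cbn -[GRing.add GRing.mul GRing.opp GRing.one GRing.zero GRing.inv
            GRing.exp]
  end.

Record quat_pair (R : rcfType) (A : starAlgType R) (Q : R[i]) (y w : A) : Prop := {
  qp_yw : y * w = Q^-1 ** (w * y);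
  qp_yws : y * w^† = Q ** (w^† * y);
  qp_yys : y * y^† = y^† * y;
  qp_wws : w^† * w - w * w^† = (1 - Q ^- 2) ** (y * y^†)
}.

Record quat_cross (R : rcfType) (A : starAlgType R) (Q zeta : R[i])
    (z1 z2 z3 z4 : A) : Prop := {
  qc_13 : z1 * z3 = zeta * Q ** (z3 * z1);
  qc_1s3 : z1^† * z3 = zeta ** (z3 * z1^†);
  qc_23 : z2 * z3 = zeta * Q ** (z3 * z2);
  qc_2s3 : z2^† * z3 = zeta ** (z3 * z2^†);
  qc_41 : z4 * z1 = zeta * Q ** (z1 * z4);
  qc_14s : z1 * z4^† - (Q - Q^-1) ** (z2^† * z3) = zeta ** (z4^† * z1);
  qc_42 : z4 * z2 = zeta * Q ** (z2 * z4);
  qc_24s : z2 * z4^† + (1 - Q ^- 2) ** (z1^† * z3) = zeta ** (z4^† * z2)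
}.

Section Covariance.
Variables (R : rcfType) (A B : starAlgType R) (Q zeta : R[i]).
Hypotheses (zeta0 : zeta != 0) (QE : Q = zeta ^- 2).
Hypotheses (QC : conjc Q = Q) (zetaC : conjc zeta = zeta).
Variables (a b c d : B).
Let Q0 : Q != 0. Proof. by rewrite QE invr_eq0 expf_neq0. Qed.
Hypotheses (ab : a * b = Q ** (b * a)) (ac : a * c = Q ** (c * a)).
Hypotheses (bd : b * d = Q ** (d * b)) (cd : c * d = Q ** (d * c)).
Hypotheses (bc : b * c = c * b).
Hypotheses (ad_da : a * d - d * a = (Q - Q^-1) ** (b * c)).
Hypotheses (det : a * d - Q ** (b * c) = 1).
Hypotheses (aS : a^† = d) (bS : b^† = - Q ** c).
Hypotheses (cS : c^† = - Q^-1 ** b) (dS : d^† = a).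

Let ad : a * d = 1 + Q ** (c * b).
Proof. by rewrite -det bc subrK. Qed.
Let da : d * a = 1 + Q^-1 ** (c * b).
Proof.
apply: oppr_inj; apply: (addrI (a * d)); rewrite ad_da ad bc.
by lin_solve R B; do ! split => //; field.
Qed.
Let suqE := (ab, ac, bd, cd, bc, ad, da).

(* If (y, w) = (z_1, z_2) or (z_3, z_4), then Y and W are the images of y and
   w under delta_R. *)
Let Y (y w : A) := y ⊗ a - Q ** (w^† ⊗ c).
Let W (y w : A) := w ⊗ a + y^† ⊗ c.
Let Ys y w : (Y y w)^† = y^† ⊗ d + w ⊗ b.
Proof.
rewrite /Y starD starN starZ !tensS starK aS cS QC tensZr.
by lin_solve R (tensor A B); do ! split => //; field.
Qed.
Let Ws y w : (W y w)^† = w^† ⊗ d - Q^-1 ** (y ⊗ b).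
Proof.
rewrite /W starD !tensS starK aS cS tensZr.
by lin_solve R (tensor A B); do ! split => //; field.
Qed.



Let mulZl (T : starAlgType R) k (x y : T) : (k ** x) * y = k ** (x * y).
Proof. by rewrite ascaleAl. Qed.
Let mulZr (T : starAlgType R) k (x y : T) : x * (k ** y) = k ** (x * y).
Proof. by rewrite ascaleAr. Qed.
Let tensNl (x : A) (y : B) : (- x) ⊗ y = - (x ⊗ y).
Proof. by rewrite -ascaleN1 tensZl ascaleN1. Qed.
Let tensNr (x : A) (y : B) : x ⊗ (- y) = - (x ⊗ y).
Proof. by rewrite -ascaleN1 tensZr ascaleN1. Qed.
Let expandE (T : starAlgType R) :=
  (@mulrDl T, @mulrDr T, @mulNr T, @mulrN T, mulZl (T := T), mulZr (T := T)).
Let linE := (tensDl, tensDr, tensZl, tensZr, tensNl, tensNr).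

Ltac coefs := lin_solve R (tensor A B); rewrite ?QE; do ! split => //; field.

Let QVC : conjc Q^-1 = Q^-1.
Proof. by rewrite (fmorphV (@conjc R)) /= QC. Qed.

Lemma quat_pair_delta y w : quat_pair Q y w -> quat_pair Q (Y y w) (W y w).
Proof.
case=> yw yws yys wws.
have Zinj k (x y' : A) : k != 0 -> x = k ** y' -> y' = k^-1 ** x.
  by move=> k0 ->; rewrite ascaleA mulVf // ascale1.
have cj (x x' : A) : x = x' -> x^† = x'^† by move=> ->.
have ysws : y^† * w^† = Q ** (w^† * y^†).
  have /cj := yw; rewrite starZ !starM QVC => /Zinj.
  by rewrite invrK => ->; rewrite ?invr_eq0.
have ysw : y^† * w = Q^-1 ** (w * y^†).
  by have /cj := yws; rewrite starZ !starM starK QC => /Zinj ->.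
have wws' : w * w^† = w^† * w - (1 - Q ^- 2) ** (y^† * y).
  by rewrite -yys -wws opprB addrC subrK.
pose rE := (yw, yws, yys, ysws, ysw, wws', suqE).
split; rewrite ?Ys ?Ws /Y /W !(expandE (tensor A B)) !tensM !rE !linE.
- by coefs.
- by coefs.
- by coefs.
- by coefs.
Qed.

Lemma quat_cross_delta y1 w1 y2 w2 :
  quat_cross Q zeta y1 w1 y2 w2 ->
  quat_cross Q zeta (Y y1 w1) (W y1 w1) (Y y2 w2) (W y2 w2).
Proof.
case=> h13 h1s3 h23 h2s3 h41 h14s h42 h24s.
have inj (k : R[i]) (x y : A) : k != 0 -> k ** x = y -> x = k^-1 ** y.
  by move=> k0 <-; rewrite ascaleA mulVf // ascale1.
have cj (x x' : A) : x = x' -> x^† = x'^† by move=> ->.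
have zQ0 : zeta * Q != 0 by rewrite mulf_neq0.
have starE (k : R[i]) (x : A) : (k ** x)^† = conjc k ** x^† by exact: starZ.
have zQC : conjc (zeta * Q) = zeta * Q by rewrite (rmorphM (@conjc R)) /= zetaC QC.
have qC1 : conjc (Q - Q^-1) = Q - Q^-1.
  by rewrite (rmorphB (@conjc R)) /= QC QVC.
have qC2 : conjc (1 - Q ^- 2) = 1 - Q ^- 2.
  rewrite -exprVn (rmorphB (@conjc R)) (rmorph1 (@conjc R)).
  by rewrite (rmorphXn (@conjc R)) /= QVC.
have r14 : y1 * w2 = (zeta * Q)^-1 ** (w2 * y1) by apply: inj.
have r24 : w1 * w2 = (zeta * Q)^-1 ** (w2 * w1) by apply: inj.
have r14s : y1 * w2^† = zeta ** (w2^† * y1) + (Q - Q^-1) * zeta ** (y2 * w1^†).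
  by rewrite -h14s h2s3 ascaleA subrK.
have r24s : w1 * w2^† = zeta ** (w2^† * w1) - (1 - Q ^- 2) * zeta ** (y2 * y1^†).
  by rewrite -h24s h1s3 ascaleA addrK.
have r13s : y1 * y2^† = zeta^-1 ** (y2^† * y1).
  by apply: inj => //; move/cj: h1s3; rewrite starE !starM !starK zetaC => ->.
have r23s : w1 * y2^† = zeta^-1 ** (y2^† * w1).
  by apply: inj => //; move/cj: h2s3; rewrite starE !starM !starK zetaC => ->.
have r1s3s : y1^† * y2^† = (zeta * Q)^-1 ** (y2^† * y1^†).
  by apply: inj => //; move/cj: h13; rewrite starE !starM zQC => ->.
have r2s3s : w1^† * y2^† = (zeta * Q)^-1 ** (y2^† * w1^†).
  by apply: inj => //; move/cj: h23; rewrite starE !starM zQC => ->.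
have r1s4s : y1^† * w2^† = zeta * Q ** (w2^† * y1^†).
  by move/cj: h41; rewrite starE !starM zQC => ->.
have r2s4s : w1^† * w2^† = zeta * Q ** (w2^† * w1^†).
  by move/cj: h42; rewrite starE !starM zQC => ->.
have r1s4 : y1^† * w2 = zeta^-1 ** (w2 * y1^† - (Q - Q^-1) ** (y2^† * w1)).
  apply: inj => //; move/cj: h14s.
  by rewrite starD starN !starE !starM !starK zetaC qC1 => ->.
have r2s4 : w1^† * w2 = zeta^-1 ** (w2 * w1^† + (1 - Q ^- 2) ** (y2^† * y1)).
  apply: inj => //; move/cj: h24s.
  by rewrite starD !starE !starM !starK zetaC qC2 => ->.
pose rE := (h13, h1s3, h23, h2s3, r14, r24, r14s, r24s, r13s, r23s, r1s3s,
  r2s3s, r1s4s, r2s4s, r1s4, r2s4, suqE).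
split; rewrite ?Ys ?Ws /Y /W !(expandE (tensor A B)) !tensM !rE !linE.
- by coefs.
- by coefs.
- by coefs.
- by coefs.
- by coefs.
- by coefs.
- by coefs.
- by coefs.
Qed.

Lemma quat_norm_delta y w : quat_pair Q y w ->
  Q ^- 2 ** (Y y w * (Y y w)^†) + (W y w)^† * W y w =
  (Q ^- 2 ** (y * y^†) + w^† * w) ⊗ 1.
Proof.
case=> yw yws yys wws.
have Zinj k (x y' : A) : k != 0 -> x = k ** y' -> y' = k^-1 ** x.
  by move=> k0 ->; rewrite ascaleA mulVf // ascale1.
have cj (x x' : A) : x = x' -> x^† = x'^† by move=> ->.
have ysws : y^† * w^† = Q ** (w^† * y^†).
  have /cj := yw; rewrite starZ !starM QVC => /Zinj.
  by rewrite invrK => ->; rewrite ?invr_eq0.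
have ysw : y^† * w = Q^-1 ** (w * y^†).
  by have /cj := yws; rewrite starZ !starM starK QC => /Zinj ->.
have wws' : w * w^† = w^† * w - (1 - Q ^- 2) ** (y^† * y).
  by rewrite -yys -wws opprB addrC subrK.
pose rE := (yw, yws, yys, ysws, ysw, wws', suqE).
rewrite ?Ys ?Ws /Y /W !(expandE (tensor A B)) !tensM !rE !linE.
by coefs.
Qed.

End Covariance.

Variant suq_gen := SUa | SUb | SUc | SUd.

Section SUq2.
Variables (R : rcfType) (q : R).
Let Q : R[i] := q%:C.
Let a : sterm R suq_gen := SGen SUa.
Let b : sterm R suq_gen := SGen SUb.
Let c : sterm R suq_gen := SGen SUc.
Let d : sterm R suq_gen := SGen SUd.
Local Open Scope sterm_scope.

Inductive SUq2_rel : sterm R suq_gen -> sterm R suq_gen -> Prop :=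
  | SUq2_ab : SUq2_rel (a * b) (Q ** (b * a))
  | SUq2_ac : SUq2_rel (a * c) (Q ** (c * a))
  | SUq2_bd : SUq2_rel (b * d) (Q ** (d * b))
  | SUq2_cd : SUq2_rel (c * d) (Q ** (d * c))
  | SUq2_bc : SUq2_rel (b * c) (c * b)
  | SUq2_ad : SUq2_rel (a * d - d * a) ((Q - Q^-1) ** (b * c))
  | SUq2_det : SUq2_rel (a * d - Q ** (b * c)) 1
  | SUq2_as : SUq2_rel (a^†) d
  | SUq2_bs : SUq2_rel (b^†) (- Q ** c)
  | SUq2_cs : SUq2_rel (c^†) (- Q^-1 ** b)
  | SUq2_ds : SUq2_rel (d^†) a.

Definition SUq2 := presented SUq2_rel.
HB.instance Definition _ := StarAlgebra.on SUq2.

Definition SUq2_mx : 'M[SUq2]_2 :=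
  \matrix_(i, j) nth 0%R (nth [::]
    [:: [:: pgen SUq2_rel SUa; pgen SUq2_rel SUb];
        [:: pgen SUq2_rel SUc; pgen SUq2_rel SUd]] i) j.

End SUq2.

Variant quat_gen := Z1 | Z2 | Z3 | Z4.

Section Sphere.
Variables (R : rcfType) (q : R).
Let Q : R[i] := q%:C.
Let zeta : R[i] := ((Num.sqrt q)^-1)%:C.
Let z1 : sterm R quat_gen := SGen Z1.
Let z2 : sterm R quat_gen := SGen Z2.
Let z3 : sterm R quat_gen := SGen Z3.
Let z4 : sterm R quat_gen := SGen Z4.
Local Open Scope sterm_scope.

Inductive quat_rel (y w : sterm R quat_gen) :
    sterm R quat_gen -> sterm R quat_gen -> Prop :=
  | quat_yw : quat_rel y w (y * w) (Q^-1 ** (w * y))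
  | quat_yws : quat_rel y w (y * w^†) (Q ** (w^† * y))
  | quat_yys : quat_rel y w (y * y^†) (y^† * y)
  | quat_wws : quat_rel y w (w^† * w - w * w^†) ((1 - Q ^- 2) ** (y * y^†)).

(* The conjugate relations hold in the quotient since [presented_eq] is a
   *-congruence. *)
Inductive H2q_rel : sterm R quat_gen -> sterm R quat_gen -> Prop :=
  | H2q_12 s t : quat_rel z1 z2 s t -> H2q_rel s t
  | H2q_34 s t : quat_rel z3 z4 s t -> H2q_rel s t
  | H2q_13 : H2q_rel (z1 * z3) (zeta * Q ** (z3 * z1))
  | H2q_1s3 : H2q_rel (z1^† * z3) (zeta ** (z3 * z1^†))
  | H2q_23 : H2q_rel (z2 * z3) (zeta * Q ** (z3 * z2))
  | H2q_2s3 : H2q_rel (z2^† * z3) (zeta ** (z3 * z2^†))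
  | H2q_41 : H2q_rel (z4 * z1) (zeta * Q ** (z1 * z4))
  | H2q_14s : H2q_rel (z1 * z4^† - (Q - Q^-1) ** (z2^† * z3))
                      (zeta ** (z4^† * z1))
  | H2q_42 : H2q_rel (z4 * z2) (zeta * Q ** (z2 * z4))
  | H2q_24s : H2q_rel (z2 * z4^† + (1 - Q ^- 2) ** (z1^† * z3))
                      (zeta ** (z4^† * z2)).

Definition S7q_r2 : sterm R quat_gen :=
  Q ^- 2 ** (z1 * z1^†) + z2^† * z2 + Q ^- 2 ** (z3 * z3^†) + z4^† * z4.

(* The quotient of the algebra of H^2_q by the ideal of r^2 - 1. *)
Inductive S7q_rel : sterm R quat_gen -> sterm R quat_gen -> Prop :=
  | S7q_H2q s t : H2q_rel s t -> S7q_rel s t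
  | S7q_sphere : S7q_rel S7q_r2 1.

Definition S7q := presented S7q_rel.
HB.instance Definition _ := StarAlgebra.on S7q.

Local Open Scope ring_scope.

Definition S7q_z (g : quat_gen) : S7q := pgen S7q_rel g.

Definition S7q_u : 'M[S7q]_(4, 2) :=
  \matrix_(i, j) nth 0 (nth [::]
    [:: [:: Q^-1 ** S7q_z Z1; - (S7q_z Z2)^†];
        [:: S7q_z Z2;         (S7q_z Z1)^†];
        [:: Q^-1 ** S7q_z Z3; - (S7q_z Z4)^†];
        [:: S7q_z Z4;         (S7q_z Z3)^†]] i) j.

Definition S7q_p : 'M[S7q]_4 := S7q_u *m (map_mx (@star R S7q) S7q_u)^T.

Definition S4q : set S7q :=
  smallest (@star_subalg R S7q) [set x | exists i j, x = S7q_p i j].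

(* The values of delta_R on z_1, z_2, z_3, z_4, read off from
   u_1^1 = q^-1 z_1, u_2^1 = z_2, u_3^1 = q^-1 z_3 and u_4^1 = z_4;
   [S7q_deltaR_u] gives those on all the u_i^j. *)
Definition S7q_deltaR_z (g : quat_gen) : tensor S7q (SUq2 q) :=
  let ua (i : 'I_4) := \sum_(mu < 2) S7q_u i mu ⊗ SUq2_mx q mu ord0 in
  match g with
  | Z1 => Q ** ua (inord 0)
  | Z2 => ua (inord 1)
  | Z3 => Q ** ua (inord 2)
  | Z4 => ua (inord 3)
  end.

Definition S7q_deltaR : S7q -> tensor S7q (SUq2 q) := plift S7q_deltaR_z.

End Sphere.

Arguments S4q {R} q.

Section DeltaR.
Variables (R : rcfType) (q : R).
Hypothesis q0 : 0 < q.
Let Q : R[i] := q%:C.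
Let zeta : R[i] := ((Num.sqrt q)^-1)%:C.
Let A := S7q q.
Let B := SUq2 q.
Let a : B := pgen _ SUa.
Let b : B := pgen _ SUb.
Let c : B := pgen _ SUc.
Let d : B := pgen _ SUd.
Let z := @S7q_z R q.

Let zetaE : zeta = (Num.sqrt q)%:C^-1.
Proof. by rewrite /zeta (fmorphV (real_complex R)). Qed.
Let zeta0 : zeta != 0.
Proof. by rewrite zetaE invr_eq0 (fmorph_eq0 (real_complex R)) gt_eqF ?sqrtr_gt0. Qed.
Let QE : Q = zeta ^- 2.
Proof.
by rewrite zetaE exprVn invrK -(rmorphXn (real_complex R)) /= sqr_sqrtr ?ltW.
Qed.
Let QC : conjc Q = Q. Proof. by rewrite /Q /= oppr0. Qed.
Let zetaC : conjc zeta = zeta. Proof. by rewrite /zeta /= oppr0. Qed.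
Let Q0 : Q != 0. Proof. by rewrite QE invr_eq0 expf_neq0. Qed.

Let suq s t : SUq2_rel q s t ->
  seval (pgen (SUq2_rel q)) s = seval (pgen (SUq2_rel q)) t.
Proof. exact: pgen_rel. Qed.

Let ad_da : a * d - d * a = (Q - Q^-1) ** (b * c).
Proof. by rewrite -ascaleN1; exact: (suq (SUq2_ad q)). Qed.
Let det : a * d - Q ** (b * c) = 1.
Proof. by rewrite -ascaleN1; exact: (suq (SUq2_det q)). Qed.

Let quatP (T : starAlgType R) (f : quat_gen -> T) (g h : quat_gen) :
  (forall s t, quat_rel q (SGen g) (SGen h) s t -> seval f s = seval f t) <->
  quat_pair Q (f g) (f h).
Proof.
split=> [H|[h1 h2 h3 h4] s t].
  split; [exact: (H _ _ (quat_yw _ _ _))|exact: (H _ _ (quat_yws _ _ _))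
         |exact: (H _ _ (quat_yys _ _ _))|].
  by have := H _ _ (quat_wws _ _ _); rewrite /= ascaleN1.
by case=> //=; rewrite ascaleN1.
Qed.

Let crossP (T : starAlgType R) (f : quat_gen -> T) :
  (forall s t, H2q_rel q s t -> seval f s = seval f t) <->
  [/\ quat_pair Q (f Z1) (f Z2), quat_pair Q (f Z3) (f Z4) &
      quat_cross Q zeta (f Z1) (f Z2) (f Z3) (f Z4)].
Proof.
split=> [H|[/quatP h12 /quatP h34 [h1 h2 h3 h4 h5 h6 h7 h8]] s t].
  split; [by apply/quatP => s t st; apply/H/H2q_12
         |by apply/quatP => s t st; apply/H/H2q_34|].
  split; [exact: (H _ _ (H2q_13 _))|exact: (H _ _ (H2q_1s3 _))
    |exact: (H _ _ (H2q_23 _))|exact: (H _ _ (H2q_2s3 _))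
    |exact: (H _ _ (H2q_41 _))| |exact: (H _ _ (H2q_42 _))
    |exact: (H _ _ (H2q_24s _))].
  by have := H _ _ (H2q_14s _); rewrite /= ascaleN1.
by case=> //=; rewrite ascaleN1.
Qed.

Let S7q_rels s t : S7q_rel q s t ->
  seval (pgen (S7q_rel q)) s = seval (pgen (S7q_rel q)) t.
Proof. exact: pgen_rel. Qed.

Let u (i : 'I_4) (j : 'I_2) := @S7q_u R q i j.
Let Y (y w : A) : tensor A B := y ⊗ a - Q ** (w^† ⊗ c).
Let W (y w : A) : tensor A B := w ⊗ a + y^† ⊗ c.

Let delta_zE : [/\ S7q_deltaR_z q Z1 = Y (z Z1) (z Z2),
  S7q_deltaR_z q Z2 = W (z Z1) (z Z2), S7q_deltaR_z q Z3 = Y (z Z3) (z Z4) &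
  S7q_deltaR_z q Z4 = W (z Z3) (z Z4)].
Proof.
split; rewrite /= !big_ord_recl big_ord0 !mxE /= !inordK //= addr0 //.
- by rewrite ascaleDr -tensZl ascaleA divff // ascale1 -(ascaleN1 (_^†))
    -!tensZl ascaleA mulrC -ascaleA !tensZl ascaleN1.
- by rewrite ascaleDr -tensZl ascaleA divff // ascale1 -(ascaleN1 (_^†))
    -!tensZl ascaleA mulrC -ascaleA !tensZl ascaleN1.
Qed.

Local Arguments S7q_deltaR_z : simpl never.

Lemma S7q_deltaR_rel s t : S7q_rel q s t ->
  seval (S7q_deltaR_z q) s = seval (S7q_deltaR_z q) t.
Proof.
have /crossP [h12 h34 hX] : forall s t, H2q_rel q s t -> seval z s = seval z t.
  by move=> s' t' /S7q_H2q /S7q_rels.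
have [e1 e2 e3 e4] := delta_zE.
have dq y w := quat_pair_delta zeta0 QE QC (suq (SUq2_ab q)) (suq (SUq2_ac q))
  (suq (SUq2_bd q)) (suq (SUq2_cd q)) (suq (SUq2_bc q)) ad_da det
  (suq (SUq2_as q)) (suq (SUq2_cs q)) (y := y) (w := w).
have dn y w : quat_pair Q y w ->
    Q ^- 2 ** (Y y w * (Y y w)^†) + (W y w)^† * W y w =
    (Q ^- 2 ** (y * y^†) + w^† * w) ⊗ 1.
  move=> h; exact: (quat_norm_delta zeta0 QE QC (suq (SUq2_ab q)) (suq (SUq2_ac q))
  (suq (SUq2_bd q)) (suq (SUq2_cd q)) (suq (SUq2_bc q)) ad_da det
    (suq (SUq2_as q)) (suq (SUq2_cs q)) h).
have dx := quat_cross_delta zeta0 QE QC zetaC (suq (SUq2_ab q)) (suq (SUq2_ac q))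
  (suq (SUq2_bd q)) (suq (SUq2_cd q)) (suq (SUq2_bc q)) ad_da det
  (suq (SUq2_as q)) (suq (SUq2_cs q)) hX.
case=> [s' t' |].
  move: s' t'; apply/crossP; rewrite e1 e2 e3 e4; split.
  - exact: dq h12.
  - exact: dq h34.
  - exact: dx.
have := S7q_rels (S7q_sphere q); rewrite /= e1 e2 e3 e4 => hr.
by rewrite (dn _ _ h12) -addrA (dn _ _ h34) -tensDl addrA hr.
Qed.

Lemma S7q_deltaR_star_hom : star_hom (@S7q_deltaR R q).
Proof. exact/plift_star_hom/S7q_deltaR_rel. Qed.

Lemma S7q_deltaR_u (i : 'I_4) (j : 'I_2) :
  S7q_deltaR (S7q_u q i j) = \sum_(mu < 2) S7q_u q i mu ⊗ SUq2_mx q mu j.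
Proof.
have hom := S7q_deltaR_star_hom.
have [e1 e2 e3 e4] := delta_zE.
have gE g : S7q_deltaR (z g) = S7q_deltaR_z q g.
  exact/plift_gen/S7q_deltaR_rel.
rewrite !big_ord_recl big_ord0 addr0 !mxE /=.
case: i => [[|[|[|[|//]]]] ?]; case: j => [[|[|//]] ?] /=; rewrite -/z
  ?(star_homN hom) ?(star_homZ hom) ?(star_homS hom) !gE ?(e1, e2, e3, e4)
  /Y /W ?starD ?starN ?starZ ?tensS ?starK -/Q
  ?[a^†](suq (SUq2_as q)) ?[c^†](suq (SUq2_cs q)) ?QC
  -?[- (_^†)]ascaleN1 ?tensZl ?tensZr /=
  -/a -/b -/c -/d -/Q;
  by cbv beta delta [reverse_coercion]; lin_solve R (tensor A B);
     do ! split => //; field.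
Qed.

End DeltaR.

(* Main.v *)
(* The upper and the lower 2x2 block of u are quaternions whose norms r1 = p_11
   and r2 = p_33 are central, lie in S4q and satisfy r1 + r2 = 1.  Write V for
   the set of entries of one block, r for its norm.  The rows of the other block
   times r are combinations of V with coefficients among the entries of p, and
   V.S4q is contained in S4q.V; hence for every x some r^n x is a combination of
   words in V with left coefficients in S4q.  After exchanging its rows, the block
   is a quantum matrix with determinant -r, so over the localization at r it yields
   an antihomomorphism psi out of SU_q(2), of antipode type, for which
   x (x) g |-> x psi(g), applied to delta_R, collapses such a combination to an
   element of S4q.  For a coinvariant x this gives r^m x in S4q.  Having this for
   both blocks, r1 + r2 = 1 puts x itself in S4q. *)
Require Import Defs.
From HB Require Import structures.
From mathcomp Require Import all_boot all_order all_algebra.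
From mathcomp Require Import generic_quotient complex boolp classical_sets reals.
From mathcomp Require Import ring zify.

Set Implicit Arguments.
Unset Strict Implicit.
Unset Printing Implicit Defensive.

Import Order.TTheory GRing.Theory Num.Theory.

Local Open Scope complex_scope.
Local Open Scope quotient_scope.
Local Open Scope ring_scope.
Local Open Scope classical_set_scope.

(** * Localization at a central element *)

(** Centrality gives fractions with no Ore condition to check, and self-adjointness lets the star
    pass to them. The proofs are bundled with the element so that [loc r] depends on [r] alone. *)
Record central_sa (R : rcfType) (A : starAlgType R) := CentralSa {
  csa :> A;
  csaC : forall x, csa * x = x * csa;
  csaS : csa^† = csa
}.

Lemma csaXC (R : rcfType) (A : starAlgType R) (r : central_sa A) n (x : A) :
  csa r ^+ n * x = x * csa r ^+ n.
Proof.
elim: n => [|n IHn]; first by rewrite expr0 mulr1 mul1r.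
by rewrite exprSr -mulrA csaC mulrA IHn mulrA.
Qed.

Lemma conjcV (R : rcfType) (k : R[i]) : conjc k = k -> conjc k^-1 = k^-1.
Proof. by move=> kC; apply: etrans (fmorphV (@conjc R) k) (congr1 GRing.inv kC). Qed.

Section Localization.
Variables (R : rcfType) (A : starAlgType R) (r : central_sa A).
Implicit Types (x y : A) (s t u : A * nat).

Let rXS n : ((r : A) ^+ n)^† = (r : A) ^+ n.
Proof. by elim: n => [|n IHn]; rewrite ?star1 // exprS starM IHn csaS -exprSr exprS. Qed.

Let rXX m n x : (r : A) ^+ m * ((r : A) ^+ n * x) = (r : A) ^+ (m + n) * x.
Proof. by rewrite mulrA -exprD. Qed.

Let rXM m n x y : (r : A) ^+ (m + n) * (x * y) = (r : A) ^+ m * x * ((r : A) ^+ n * y).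
Proof. by rewrite exprD -!mulrA; congr (_ * _); rewrite !mulrA csaXC. Qed.

(** The pair [(x, n)] stands for the fraction [r^-n x]. The free power [r^k] is there because [r]
    may be a zero divisor; transitivity would otherwise need cancellation. *)
Definition loc_eq s t := exists k,
  (r : A) ^+ (k + t.2) * s.1 = (r : A) ^+ (k + s.2) * t.1.

Definition loc_eqb s t := `[< loc_eq s t >].

Lemma loc_eqb_refl : reflexive loc_eqb.
Proof. by move=> s; apply/asboolP; exists 0%N. Qed.
Lemma loc_eqb_sym : symmetric loc_eqb.
Proof. by move=> s t; apply/asboolP/asboolP=> -[k] ?; exists k. Qed.
Lemma loc_eqb_trans : transitive loc_eqb.
Proof.
(* Passing through the middle fraction [t] costs its exponent [t.2] in the power of [r]. *)
move=> t s u /asboolP[k st] /asboolP[l tu]; apply/asboolP; exists (k + l + t.2)%N.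
rewrite (_ : (_ + u.2 = (l + u.2) + (k + t.2))%N); last by lia.
rewrite -rXX st rXX addnC -rXX tu rXX; congr (_ ^+ _ * _); lia.
Qed.

Canonical loc_equiv := EquivRel loc_eqb loc_eqb_refl loc_eqb_sym loc_eqb_trans.

Definition loc := {eq_quot loc_equiv}.

HB.instance Definition _ := Choice.on loc.
HB.instance Definition _ := EqQuotient.on loc.

Lemma locP s t : \pi_loc s = \pi_loc t <-> loc_eq s t.
Proof. by split=> [/eqquotP/asboolP|st]; last by apply/eqquotP/asboolP. Qed.

Let add_pre s t := ((r : A) ^+ t.2 * s.1 + (r : A) ^+ s.2 * t.1, (s.2 + t.2)%N).
Let mul_pre s t := (s.1 * t.1, (s.2 + t.2)%N).
Let scale_pre (c : R[i]) s := (c ** s.1, s.2).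
Let star_pre s := (s.1^†, s.2).

Definition l_add := locked (fun x y : loc => \pi_loc (add_pre (repr x) (repr y))).
Definition l_mul := locked (fun x y : loc => \pi_loc (mul_pre (repr x) (repr y))).
Definition l_scale := locked (fun (c : R[i]) (x : loc) =>
  \pi_loc (scale_pre c (repr x))).
Definition l_star := locked (fun x : loc => \pi_loc (star_pre (repr x))).

Let repr_leq s : loc_eq (repr (\pi_loc s)) s.
Proof. by apply/locP; rewrite reprK. Qed.

Let l_addE s t : l_add (\pi_loc s) (\pi_loc t) = \pi_loc (add_pre s t).
Proof.
rewrite /l_add -lock; apply/locP.
have [k /= hs] := repr_leq s; have [l /= ht] := repr_leq t.
move: (repr (\pi_loc s)) (repr (\pi_loc t)) hs ht => s' t' hs ht.
exists (k + l)%N; rewrite /= !mulrDr !rXX; congr (_ + _).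
  rewrite (_ : (_ + t'.2 = (l + t.2 + t'.2) + (k + s.2))%N); last by lia.
  by rewrite -rXX hs rXX; congr (_ ^+ _ * _); lia.
rewrite (_ : (_ + s'.2 = (k + s.2 + s'.2) + (l + t.2))%N); last by lia.
by rewrite -rXX ht rXX; congr (_ ^+ _ * _); lia.
Qed.
Let l_mulE s t : l_mul (\pi_loc s) (\pi_loc t) = \pi_loc (mul_pre s t).
Proof.
rewrite /l_mul -lock; apply/locP.
have [k /= hs] := repr_leq s; have [l /= ht] := repr_leq t.
move: (repr (\pi_loc s)) (repr (\pi_loc t)) hs ht => s' t' hs ht.
exists (k + l)%N => /=.
rewrite (_ : (k + l + (s.2 + t.2) = (k + s.2) + (l + t.2))%N); last by lia.
rewrite (_ : (k + l + (s'.2 + t'.2) = (k + s'.2) + (l + t'.2))%N); last by lia.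
by rewrite !rXM hs ht.
Qed.
Let l_scaleE c s : l_scale c (\pi_loc s) = \pi_loc (scale_pre c s).
Proof.
rewrite /l_scale -lock; apply/locP; have [k /= hs] := repr_leq s.
by exists k; rewrite /= -!ascaleAr hs.
Qed.
Let l_starE s : l_star (\pi_loc s) = \pi_loc (star_pre s).
Proof.
rewrite /l_star -lock; apply/locP; have [k /= hs] := repr_leq s.
by exists k; rewrite /= !csaXC -rXS -starM hs starM rXS.
Qed.
Let lE := (l_addE, l_mulE, l_scaleE, l_starE).

Fact l_addA : associative l_add.
Proof.
elim/quotW=> s; elim/quotW=> t; elim/quotW=> u; rewrite !lE; congr \pi.
rewrite /add_pre /= !mulrDr !rXX addrA addnA.
by congr (_ ^+ _ * _ + _ ^+ _ * _ + _ ^+ _ * _, _); lia.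
Qed.
Fact l_addC : commutative l_add.
Proof. by elim/quotW=> s; elim/quotW=> t; rewrite !lE /add_pre addrC addnC. Qed.
Fact l_add0 : left_id (\pi_loc (0, 0%N)) l_add.
Proof.
by elim/quotW=> -[x n]; rewrite !lE /add_pre /= mulr0 add0r expr0 mul1r.
Qed.
Fact l_addN : left_inverse (\pi_loc (0, 0%N)) (l_scale (-1)) l_add.
Proof.
elim/quotW=> s; rewrite !lE; apply/locP; exists 0%N.
by rewrite /= ascaleN1 -mulrDr addNr !mulr0.
Qed.

HB.instance Definition _ := GRing.isZmodule.Build loc l_addA l_addC l_add0 l_addN.

Fact l_mulA : associative l_mul.
Proof.
by elim/quotW=> s; elim/quotW=> t; elim/quotW=> u; rewrite !lE /mul_pre /= mulrA addnA.
Qed.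
Fact l_mul1l : left_id (\pi_loc (1, 0%N)) l_mul.
Proof. by elim/quotW=> -[x n]; rewrite !lE /mul_pre /= mul1r. Qed.
Fact l_mul1r : right_id (\pi_loc (1, 0%N)) l_mul.
Proof. by elim/quotW=> -[x n]; rewrite !lE /mul_pre /= mulr1 addn0. Qed.
Fact l_mulDl : left_distributive l_mul l_add.
Proof.
elim/quotW=> s; elim/quotW=> t; elim/quotW=> u; rewrite !lE; apply/locP.
exists 0%N; rewrite /= mulrDl -!mulrA !mulrDr !rXX.
by congr (_ ^+ _ * _ + _ ^+ _ * _); lia.
Qed.
Fact l_mulDr : right_distributive l_mul l_add.
Proof.
elim/quotW=> s; elim/quotW=> t; elim/quotW=> u; rewrite !lE; apply/locP.
exists 0%N; rewrite /= mulrDr !(mulrA s.1) -!(csaXC r _ s.1) -!mulrA !mulrDr !rXX.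
by congr (_ ^+ _ * _ + _ ^+ _ * _); lia.
Qed.

HB.instance Definition _ := GRing.Zmodule_isPzRing.Build loc
  l_mulA l_mul1l l_mul1r l_mulDl l_mulDr.

Fact l_scaleA c d (x : loc) : l_scale c (l_scale d x) = l_scale (c * d) x.
Proof. by elim/quotW: x => s; rewrite !lE /scale_pre /= ascaleA. Qed.
Fact l_scale1 : left_id 1 l_scale.
Proof. by elim/quotW=> -[x n]; rewrite !lE /scale_pre /= ascale1. Qed.
Fact l_scaleDr : right_distributive l_scale l_add.
Proof.
move=> c; elim/quotW=> s; elim/quotW=> t.
by rewrite !lE /scale_pre /add_pre /= ascaleDr !ascaleAr.
Qed.
Fact l_scaleDl (x : loc) : {morph l_scale^~ x : c d / c + d >-> l_add c d}.
Proof.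
elim/quotW: x => s c d; rewrite !lE; apply/locP; exists 0%N.
by rewrite /= ascaleDl -mulrDr rXX.
Qed.
Fact l_scaleAl c (x y : loc) : l_scale c (l_mul x y) = l_mul (l_scale c x) y.
Proof.
by elim/quotW: x => s; elim/quotW: y => t; rewrite !lE /scale_pre /= ascaleAl.
Qed.
Fact l_scaleAr c (x y : loc) : l_scale c (l_mul x y) = l_mul x (l_scale c y).
Proof.
by elim/quotW: x => s; elim/quotW: y => t; rewrite !lE /scale_pre /= ascaleAr.
Qed.
Fact l_starK : involutive l_star.
Proof. by elim/quotW=> -[x n]; rewrite !lE /star_pre /= starK. Qed.
Fact l_starD (x y : loc) : l_star (l_add x y) = l_add (l_star x) (l_star y).
Proof.
elim/quotW: x => s; elim/quotW: y => t.
by rewrite !lE /star_pre /add_pre /= starD !starM !rXS -!csaXC.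
Qed.
Fact l_starM (x y : loc) : l_star (l_mul x y) = l_mul (l_star y) (l_star x).
Proof.
elim/quotW: x => s; elim/quotW: y => t.
by rewrite !lE /star_pre /mul_pre /= starM addnC.
Qed.
Fact l_starZ c (x : loc) : l_star (l_scale c x) = l_scale (conjc c) (l_star x).
Proof. by elim/quotW: x => s; rewrite !lE /star_pre /scale_pre /= starZ. Qed.

HB.instance Definition _ := isStarAlgebra.Build R loc
  l_scaleA l_scale1 l_scaleDr l_scaleDl l_scaleAl l_scaleAr
  l_starK l_starD l_starM l_starZ.

Definition toloc x : loc := \pi_loc (x, 0%N).
Definition locV : loc := \pi_loc (1, 1%N).

Lemma tolocD x y : toloc (x + y) = toloc x + toloc y.
Proof. by rewrite [RHS]l_addE /add_pre /= expr0 !mul1r. Qed.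
Lemma tolocM x y : toloc (x * y) = toloc x * toloc y.
Proof. by rewrite [RHS]l_mulE. Qed.
Lemma tolocZ c x : toloc (c ** x) = c ** toloc x.
Proof. by rewrite [RHS]l_scaleE. Qed.
Lemma tolocN x : toloc (- x) = - toloc x.
Proof. by rewrite -!ascaleN1 tolocZ. Qed.

Lemma locVr : locV * toloc r = 1.
Proof.
rewrite [LHS]l_mulE; apply/locP; exists 0%N.
by rewrite /= expr0 expr1 !mul1r mulr1.
Qed.
Lemma locVC (x : loc) : locV * x = x * locV.
Proof.
by elim/quotW: x => s; rewrite [LHS]l_mulE [RHS]l_mulE /mul_pre mul1r mulr1 addnC.
Qed.
Lemma toloc_csaC (x : loc) : toloc r * x = x * toloc r.
Proof.
by elim/quotW: x => s; rewrite [LHS]l_mulE [RHS]l_mulE /mul_pre /= csaC addnC.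
Qed.
(** The kernel of [toloc] is the [r]-power torsion, so an equality of fractions returns to [A] only
    up to a power of [r]. Gluing the two blocks removes that power in the end. *)
Lemma toloc_eq x y : toloc x = toloc y -> exists n, (r : A) ^+ n * x = (r : A) ^+ n * y.
Proof. by case/locP => k; rewrite /= addn0; exists k. Qed.

End Localization.

(** * Linear maps on tensor products and antihomomorphisms on presented algebras *)

Section TensorLift.
Variables (R : rcfType) (A B T : starAlgType R) (f : A -> B -> T).
Hypotheses (fDl : forall b, {morph f^~ b : a a' / a + a'}).
Hypotheses (fDr : forall a, {morph f a : b b' / b + b'}).
Hypothesis fZ : forall c a b, f (c ** a) b = f a (c ** b).

(** Multiplicativity is not asked of [f]: for an antihomomorphism [psi] the map [x ⊗ g |-> x psi(g)]
    is in general only linear. *)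
Definition tlift (x : tensor A B) : T := \sum_(p <- repr x) f p.1 p.2.

Let sum_tens_eq s t : tens_eq s t ->
  \sum_(p <- s) f p.1 p.2 = \sum_(p <- t) f p.1 p.2.
Proof.
elim=> //=.
- by move=> s1 s2 s3 _ -> _ ->.
- by move=> s1 s2 t1 t2 _ e1 _ e2; rewrite !big_cat e1 e2.
- by move=> s1 t1; rewrite !big_cat; apply: addrC.
- move=> b; rewrite big_seq1 big_nil /=.
  by apply: (addIr (f 0 b)); rewrite -fDl !add0r.
- by move=> a a' b; rewrite big_seq1 big_cons big_seq1 /= fDl.
- by move=> a b b'; rewrite big_seq1 big_cons big_seq1 /= fDr.
- by move=> c a b; rewrite !big_seq1 /= fZ.
Qed.

Lemma tlift_pi s : tlift (\pi_(tensor A B) s) = \sum_(p <- s) f p.1 p.2.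
Proof. by apply/sum_tens_eq/tensorP; rewrite reprK. Qed.

Lemma tlift_tens a b : tlift (a ⊗ b) = f a b.
Proof. by rewrite tlift_pi big_seq1. Qed.

Lemma tliftD : {morph tlift : x y / x + y}.
Proof.
elim/quotW=> s; elim/quotW=> t.
have -> : \pi_(tensor A B) s + \pi_(tensor A B) t =
    \pi_(tensor A B) (s ++ t).
  by rewrite !tensor_sum big_cat.
by rewrite !tlift_pi big_cat.
Qed.

Lemma tlift0 : tlift 0 = 0.
Proof. by apply: (addIr (tlift 0)); rewrite -tliftD !add0r. Qed.

End TensorLift.

(* An antihomomorphism need not be compatible with the star, so the values on
   the stars of the generators, [g true], are independent of those on the
   generators, [g false]. *)
Section AntiLift.
Variables (R : rcfType) (G : Type) (rel : sterm R G -> sterm R G -> Prop).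
Variables (T : starAlgType R) (g : bool -> G -> T).

(** The flag tells whether an odd number of stars encloses the term, so [aeval true t] is the value
    at the star of [t]. There the star and the antihomomorphism each reverse a product, which
    restores its order. *)
Fixpoint aeval (b : bool) (t : sterm R G) : T :=
  match t with
  | SGen x => g b x
  | SZero => 0
  | SOne => 1
  | SAdd s t => aeval b s + aeval b t
  | SMul s t => if b then aeval b s * aeval b t else aeval b t * aeval b s
  | SScale c t => (if b then conjc c else c) ** aeval b t
  | SStar t => aeval (~~ b) t
  end.

Hypothesis g_rel : forall b s t, rel s t -> aeval b s = aeval b t.

Lemma aeval_eq b s t : presented_eq rel s t -> aeval b s = aeval b t.
Proof.
(* Both flags are treated at once, since the congruence rule for the star exchanges them. *)
move=> st; elim: st b => {s t} //=.
- by move=> s t /g_rel.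
- by move=> s1 s2 s3 _ e1 _ e2 b; rewrite e1 e2.
- by move=> s1 s2 t1 t2 _ e1 _ e2 b; rewrite e1 e2.
- by move=> s1 s2 t1 t2 _ e1 _ e2 b; rewrite e1 e2.
- by move=> c s1 s2 _ e1 b; rewrite e1.
- by move=> s1 s2 s3 b; rewrite addrA.
- by move=> s1 s2 b; rewrite addrC.
- by move=> s1 b; rewrite add0r.
- move=> s1 b; rewrite (_ : (if b then _ else _) = -1) ?ascaleN1 ?addNr //.
  by case: b; rewrite // [LHS](rmorphN1 (@conjc R)).
- by move=> s1 s2 s3 []; rewrite mulrA.
- by move=> s1 []; rewrite ?mul1r ?mulr1.
- by move=> s1 []; rewrite ?mul1r ?mulr1.
- by move=> s1 s2 s3 []; rewrite ?mulrDl ?mulrDr.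
- by move=> s1 s2 s3 []; rewrite ?mulrDl ?mulrDr.
- by move=> c d s1 []; rewrite ascaleA ?(rmorphM (@conjc R)).
- move=> s1 b; rewrite (_ : (if b then _ else _) = 1) ?ascale1 //.
  by case: b; rewrite // [LHS](rmorph1 (@conjc R)).
- by move=> c s1 s2 b; rewrite ascaleDr.
- by move=> c d s1 []; rewrite ?(rmorphD (@conjc R)) ascaleDl.
- by move=> c s1 s2 []; rewrite ascaleAl -?ascaleAr // ascaleAl.
- by move=> c s1 s2 []; rewrite ascaleAl -?ascaleAr // ascaleAl.
- by move=> s1 b; rewrite negbK.
- by move=> s1 s2 [].
- by move=> c s1 []; rewrite ?conjcK.
Qed.

Definition alift (x : presented rel) : T := aeval false (repr x).

Lemma alift_pi s : alift (\pi_(presented rel) s) = aeval false s.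
Proof. by apply: aeval_eq; apply/presentedP; rewrite reprK. Qed.

Lemma alift_gen x : alift (pgen rel x) = g false x.
Proof. exact: alift_pi. Qed.

Lemma alift1 : alift 1 = 1.
Proof. exact: alift_pi. Qed.

Lemma aliftD : {morph alift : x y / x + y}.
Proof.
elim/quotW=> s; elim/quotW=> t.
by rewrite -!seval_pgen -[_ + _]/(seval (pgen rel) (SAdd s t)) !seval_pgen !alift_pi.
Qed.

Lemma aliftZ c x : alift (c ** x) = c ** alift x.
Proof.
elim/quotW: x => s.
by rewrite -!seval_pgen -[_ ** _]/(seval (pgen rel) (SScale c s)) !seval_pgen !alift_pi.
Qed.

Lemma aliftM x y : alift (x * y) = alift y * alift x.
Proof.
elim/quotW: x => s; elim/quotW: y => t.
by rewrite -!seval_pgen -[_ * _]/(seval (pgen rel) (SMul s t)) !seval_pgen !alift_pi.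
Qed.

End AntiLift.

(** * Quantum 2x2 matrices and the antipode *)

Record q_matrix (R : rcfType) (A : starAlgType R) (Q : R[i]) (a b c d : A) : Prop := {
  qm_ab : a * b = Q ** (b * a);
  qm_ac : a * c = Q ** (c * a);
  qm_bd : b * d = Q ** (d * b);
  qm_cd : c * d = Q ** (d * c);
  qm_bc : b * c = c * b;
  qm_ad : a * d - d * a = (Q - Q^-1) ** (b * c)
}.

Lemma ascaleMl (R : rcfType) (A : starAlgType R) k (x y : A) :
  (k ** x) * y = k ** (x * y).
Proof. by rewrite ascaleAl. Qed.

Lemma ascaleMr (R : rcfType) (A : starAlgType R) k (x y : A) :
  x * (k ** y) = k ** (x * y).
Proof. by rewrite ascaleAr. Qed.

Lemma ascaleNl (R : rcfType) (A : starAlgType R) k (x : A) : (- k) ** x = - (k ** x).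
Proof. by rewrite -ascaleN1 ascaleA mulN1r. Qed.

Section Antipode.
Variables (R : rcfType) (q : R) (T : starAlgType R) (a b c d e : T).
Let Q : R[i] := q%:C.
Hypothesis Q0 : Q != 0.
Hypothesis qm : q_matrix Q a b c d.
Hypothesis eC : forall x, e * x = x * e.
Hypothesis e_det : e * (a * d - Q ** (b * c)) = 1.

Let ead : e * (a * d) = 1 + Q ** (e * (c * b)).
Proof. by rewrite -e_det mulrBr ascaleMr -(qm_bc qm) subrK. Qed.
Let eda : e * (d * a) = 1 + Q^-1 ** (e * (c * b)).
Proof.
rewrite -[d * a](subKr (a * d)) (qm_ad qm) (qm_bc qm) mulrBr ead ascaleMr.
by lin_solve R T; do ! split => //; field.
Qed.
Let xe x y : x * (e * y) = e * (x * y).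
Proof. by rewrite mulrA -eC mulrA. Qed.

(* The antipode of SU_q(2) composed with the map given by the matrix (a, b; c, d)
   of determinant 1/e, up to the automorphism that scales the second column of
   the antipode matrix by e and thereby avoids a square root of e. *)
Definition anti_gen (st : bool) (g : suq_gen) : T :=
  match g, st with
  | SUa, false | SUd, true => d
  | SUb, false => (- Q^-1) ** (e * b)
  | SUc, false => (- Q) ** c
  | SUd, false | SUa, true => e * a
  | SUb, true => (Q ^+ 2) ** c
  | SUc, true => (Q ^- 2) ** (e * b)
  end.

(** The values on starred generators are forced by the star relations: [b^† = -q c], for instance,
    must go to [-Q] times [-Q c], which is [Q^2 c]. *)
Lemma anti_gen_rel st s t : SUq2_rel q s t -> aeval anti_gen st s = aeval anti_gen st t.
Proof.
have QC : conjc Q = Q by rewrite /Q /= oppr0.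
have QVC := conjcV QC.
have QNC : conjc (- Q) = - Q by exact: etrans (rmorphN (@conjc R) Q) (congr1 -%R QC).
have QNVC : conjc (- Q^-1) = - Q^-1.
  exact: etrans (rmorphN (@conjc R) Q^-1) (congr1 -%R QVC).
have QBC : conjc (Q - Q^-1) = Q - Q^-1.
  exact: etrans (rmorphB (@conjc R) Q Q^-1) (congr2 (fun x y => x - y) QC QVC).
have N1C : conjc (-1 : R[i]) = -1 by rewrite (rmorphN1 (@conjc R)).
pose rE := (ead, eda, qm_ab qm, qm_ac qm, qm_bd qm, qm_cd qm, qm_bc qm).
case; case: st; cbn [aeval anti_gen negb]; rewrite -/Q ?(QC, QVC, QNC, QNVC, QBC, N1C) //.
all: rewrite ?(ascaleMl, ascaleMr) -?mulrA ?(xe, ascaleMl, ascaleMr, rE).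
all: lin_solve R T; do ! split => //; field.
all: by rewrite ?Q0.
Qed.

Definition anti : SUq2 q -> T := alift anti_gen.

Let g x : SUq2 q := pgen _ x.

Lemma anti_genE : (anti (g SUa) = d) * (anti (g SUb) = (- Q^-1) ** (e * b)) *
  (anti (g SUc) = (- Q) ** c) * (anti (g SUd) = e * a).
Proof. by rewrite /anti !(alift_gen anti_gen_rel). Qed.

Lemma anti1 : anti 1 = 1.
Proof. exact: (alift1 anti_gen_rel). Qed.

Lemma antiD : {morph anti : x y / x + y}.
Proof. exact: (aliftD anti_gen_rel). Qed.

Lemma antiZ k x : anti (k ** x) = k ** anti x.
Proof. exact: (aliftZ anti_gen_rel). Qed.

Lemma antiM x y : anti (x * y) = anti y * anti x.
Proof. exact: (aliftM anti_gen_rel). Qed.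

End Antipode.

(** * Combinations of words with coefficients in a subalgebra *)

Section StarSubalgTheory.
Variables (R : rcfType) (A : starAlgType R) (S : set A).
Hypothesis S_alg : star_subalg S.

Lemma star_subalgD x y : S x -> S y -> S (x + y).
Proof. by move=> Sx Sy; rewrite -[x]ascale1; apply: star_subalgL. Qed.

Lemma star_subalg0 : S 0.
Proof.
have S1 := star_subalg1 S_alg.
by have := star_subalgL S_alg (-1) S1 S1; rewrite ascaleN1 addNr.
Qed.

Lemma star_subalgZ k x : S x -> S (k ** x).
Proof. by move=> Sx; rewrite -[_ ** _]addr0; apply: star_subalgL star_subalg0. Qed.

Lemma star_subalgN x : S x -> S (- x).
Proof. by rewrite -ascaleN1; apply: star_subalgZ. Qed.

Lemma star_subalgX n x : S x -> S (x ^+ n).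
Proof.
move=> Sx; elim: n => [|n IHn]; first exact: star_subalg1.
by rewrite exprS; apply: star_subalgM.
Qed.

End StarSubalgTheory.

Section RightSpan.
Variables (R : rcfType) (A : starAlgType R) (S : set A) (V : seq A).

(** Words grow on the right only, so that an induction peels off the last letter while the
    coefficient from [S] stays on the left. *)
Inductive rspan : A -> Prop :=
  | rspan_sub s : S s -> rspan s
  | rspanD x y : rspan x -> rspan y -> rspan (x + y)
  | rspanZ k x : rspan x -> rspan (k ** x)
  | rspanM x v : rspan x -> v \in V -> rspan (x * v).

(** The elements that preserve the span from the right form a subalgebra, so stability need only be
    checked on generators. *)
Definition rstable y := forall x, rspan x -> rspan (x * y).

Lemma rstable1 : rstable 1.
Proof. by move=> x; rewrite mulr1. Qed.

Lemma rstableV v : v \in V -> rstable v.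
Proof. by move=> vV x xM; apply: rspanM. Qed.

Lemma rstableD y z : rstable y -> rstable z -> rstable (y + z).
Proof. by move=> yM zM x xM; rewrite mulrDr; apply: rspanD; auto. Qed.

Lemma rstableZ k y : rstable y -> rstable (k ** y).
Proof. by move=> yM x xM; rewrite ascaleMr; apply: rspanZ; auto. Qed.

Lemma rstableM y z : rstable y -> rstable z -> rstable (y * z).
Proof. by move=> yM zM x xM; rewrite mulrA; auto. Qed.

(** A factor from [P] travels left through the word one letter at a time until the coefficient in
    [S] absorbs it. The induction closes because each exchange produces factors that lie in [P]
    again. *)
Lemma rstable_swap (P : seq A) : star_subalg S -> (forall p, p \in P -> S p) ->
  (forall v p, v \in V -> p \in P -> exists k p' v' k' p'' v'',
    [/\ p' \in P, p'' \in P, v' \in V, v'' \in V &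
        v * p = k ** (p' * v') + k' ** (p'' * v'')]) ->
  forall p, p \in P -> rstable p.
Proof.
move=> S_alg PS swap p pP x xM. elim: xM p pP => {x} [s Ss|x y _ IHx _ IHy|k x _ IHx
    |x v _ IHx vV] p pP.
- by apply: rspan_sub; apply: (star_subalgM S_alg Ss); apply: PS.
- by rewrite mulrDl; apply: rspanD; auto.
- by rewrite ascaleMl; apply: rspanZ; auto.
- have [k [p' [v' [k' [p'' [v'' [Pp' Pp'' Vv' Vv'' eq_vp]]]]]]] := swap v p vV pP.
  rewrite -mulrA eq_vp mulrDr !ascaleMr !mulrA.
  by apply: rspanD; apply: rspanZ; apply: rspanM; auto.
Qed.

End RightSpan.

Lemma quat_pair_rev (R : rcfType) (A : starAlgType R) (Q : R[i]) (y w : A) :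
  conjc Q = Q -> Q != 0 -> quat_pair Q y w ->
  [/\ w * y = Q ** (y * w), w * y^† = Q ** (y^† * w),
      w^† * y = Q^-1 ** (y * w^†) & w^† * y^† = Q^-1 ** (y^† * w^†)].
Proof.
move=> QC Q0 [yw yws yys wws].
have inj k (x x' : A) : k != 0 -> x = k ** x' -> x' = k^-1 ** x.
  by move=> k0 ->; rewrite ascaleA mulVf // ascale1.
have QVC := conjcV QC.
split.
- by have := inj _ _ _ (invr_neq0 Q0) yw; rewrite invrK.
- by have := congr1 (@star R A) yws; rewrite starZ QC !starM starK.
- exact: inj yws.
- by have := congr1 (@star R A) yw; rewrite starZ QVC !starM.
Qed.

(** * Descent of coinvariants over the localization at one norm *)

Section Descent.
Variables (R : rcfType) (q : R) (A : starAlgType R).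
Let Q : R[i] := q%:C.
Let QC : conjc Q = Q. Proof. by rewrite /Q /= oppr0. Qed.
Let B := SUq2 q.
Variables (dl : A -> tensor A B) (S : set A) (r : central_sa A) (y w : A).
Hypothesis Q0 : Q != 0.
Hypothesis dl_hom : star_hom dl.
Hypothesis S_alg : star_subalg S.
Hypothesis S_coinv : forall s, S s -> dl s = s ⊗ 1.
Hypothesis Sr : S r.
Hypothesis yw : quat_pair Q y w.
Hypothesis rE : csa r = Q ^- 2 ** (y * y^†) + w^† * w.
(** The rows are exchanged because in the original order the first column would satisfy
    [a c = Q^-1 c a], with the wrong power of [Q]. *)
Let a := w.
Let b := y^†.
Let c := Q^-1 ** y.
Let d := - w^†.
Let g x : B := pgen (SUq2_rel q) x.
Hypothesis dla : dl a = a ⊗ g SUa + b ⊗ g SUc.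
Hypothesis dlb : dl b = a ⊗ g SUb + b ⊗ g SUd.
Hypothesis dlc : dl c = c ⊗ g SUa + d ⊗ g SUc.
Hypothesis dld : dl d = c ⊗ g SUb + d ⊗ g SUd.

Let qm : q_matrix Q a b c d.
Proof.
have [wy wys wsy wsys] := quat_pair_rev QC Q0 yw; case: yw => _ yws yys wws.
split; rewrite /a /b /c /d -?(ascaleN1 w^†) ?(ascaleMl, ascaleMr).
- exact: wys.
- by rewrite wy !ascaleA mulrC.
- by rewrite wsys !ascaleA; congr (_ ** _); field.
- by rewrite yws !ascaleA; congr (_ ** _); field.
- by rewrite yys.
- rewrite !ascaleN1 opprK addrC wws -yys ascaleA; congr (_ ** _).
  by field.
Qed.

Let det : a * d - Q ** (b * c) = - csa r.
Proof.
have wwsE : w * w^† = w^† * w - (1 - Q ^- 2) ** (y * y^†).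
  by rewrite -(qp_wws yw) subKr.
rewrite rE mulrN wwsE ascaleMr ascaleA divff // ascale1 -(qp_yys yw).
by lin_solve R A; do ! split => //; field.
Qed.

Let T := loc r.
Local Notation L := (@toloc R A r).
Let e : T := - locV r.

Let qmL : q_matrix Q (L a) (L b) (L c) (L d).
Proof.
by split; rewrite -!tolocM -?tolocZ -?tolocN -?tolocD;
   rewrite ?(qm_ab qm, qm_ac qm, qm_bd qm, qm_cd qm, qm_bc qm, qm_ad qm).
Qed.

Let eC x : e * x = x * e.
Proof. by rewrite mulNr locVC mulrN. Qed.

Let e_det : e * (L a * L d - Q ** (L b * L c)) = 1.
Proof. by rewrite -!tolocM -tolocZ -tolocN -tolocD det tolocN mulrNN locVr. Qed.

Local Notation psi := (@anti R q T (L a) (L b) (L c) (L d) e).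
Let psiE := anti_genE Q0 qmL eC e_det.
Local Notation Psi := (@tlift R A B T (fun u v => L u * psi v)).

Let fDl t : {morph (fun x => L x * psi t) : x x' / x + x'}.
Proof. by move=> x x'; rewrite tolocD mulrDl. Qed.
Let fDr x : {morph (fun t => L x * psi t) : t t' / t + t'}.
Proof. by move=> t t'; rewrite (antiD Q0 qmL eC e_det) mulrDr. Qed.
Let fZ k x t : L (k ** x) * psi t = L x * psi (k ** t).
Proof. by rewrite tolocZ (antiZ Q0 qmL eC e_det) ascaleMl ascaleMr. Qed.

Let Psi_tens x t : Psi (x ⊗ t) = L x * psi t.
Proof. exact: (tlift_tens fDl fDr fZ). Qed.
Let PsiD x t : Psi (x + t) = Psi x + Psi t.
Proof. exact: (tliftD fDl fDr fZ). Qed.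
Let Psi0 : Psi 0 = 0.
Proof. exact: (tlift0 fDl fDr fZ). Qed.

Let PsiZ k X : Psi (k ** X) = k ** Psi X.
Proof.
elim/tensor_ind: X => [|x t X IHX]; first by rewrite ascale0 Psi0 ascale0.
by rewrite ascaleDr !PsiD IHX -tensZl !Psi_tens tolocZ ascaleMl ascaleDr.
Qed.

(** As [psi] reverses products, [(x ⊗ n)(u ⊗ t)] goes to [x u psi(t) psi(n)]: a factor appended on
    the right meets its own [psi]-value. The bracket so formed is the central [k] and can be pulled
    out. *)
Let PsiMr X u v t z (k : T) : (forall x, k * x = x * k) ->
  L u * psi t + L v * psi z = k -> Psi (X * (u ⊗ t + v ⊗ z)) = k * Psi X.
Proof.
move=> kC uv; elim/tensor_ind: X => [|x n X IHX].
  by rewrite mul0r Psi0 mulr0.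
rewrite mulrDl !PsiD IHX [RHS]mulrDr; congr (_ + _).
rewrite mulrDr !tensM PsiD !Psi_tens !(antiM Q0 qmL eC e_det) !tolocM.
transitivity (L x * (L u * psi t + L v * psi z) * psi n).
  by rewrite mulrDr mulrDl !mulrA.
by rewrite uv -kC mulrA.
Qed.

(** The matrix [(a, b; c, d)] times the [psi]-image of the generating matrix of [SU_q(2)] is
    diagonal with entries [-r] and [1]. Hence appending [a], [b], [c] or [d] multiplies the value by
    [-r], [0], [0] or [1], and the value never leaves [S]. *)
Lemma dl_rspan m : rspan S [:: y; w; y^†; w^†] m ->
  exists2 s, S s & Psi (dl m) = L s.
Proof.
have hM := (star_homM dl_hom).2.
have NrC x' : L (- csa r) * x' = x' * L (- csa r).
  by rewrite tolocN mulNr toloc_csaC mulrN.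
have [pa pb pc pd] : [/\ psi (g SUa) = L d, psi (g SUb) = (- Q^-1) ** (e * L b),
  psi (g SUc) = (- Q) ** L c & psi (g SUd) = e * L a] by rewrite !psiE.
have Pa x : (exists2 s, S s & Psi (dl x) = L s) ->
    exists2 s, S s & Psi (dl (x * a)) = L s.
  case=> s Ss es; exists ((- csa r) * s).
    by apply: star_subalgM => //; apply: star_subalgN.
  rewrite hM dla tolocM -es; apply: PsiMr NrC _.
  by rewrite pa pc -tolocZ -!tolocM -tolocD ascaleMr -det ascaleNl.
have Pb x : Psi (dl (x * b)) = 0.
  rewrite hM dlb -(mul0r (Psi (dl x))); apply: PsiMr => [t|].
    by rewrite mul0r mulr0.
  rewrite pb pd ascaleMr !mulrA -!eC -!mulrA (qm_ab qmL).
  by rewrite ascaleMr ascaleA mulNr mulVf // ascaleN1 addNr.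
have Pc x : Psi (dl (x * c)) = 0.
  rewrite hM dlc -(mul0r (Psi (dl x))); apply: PsiMr => [t|].
    by rewrite mul0r mulr0.
  by rewrite pa pc ascaleMr (qm_cd qmL) -ascaleDl addrN ascale0l.
have Pd x : Psi (dl (x * d)) = Psi (dl x).
  rewrite hM dld -[RHS]mul1r; apply: PsiMr => [t|].
    by rewrite mul1r mulr1.
  have da : L d * L a = L a * L d - (Q - Q^-1) ** (L b * L c).
    by rewrite -(qm_ad qmL) subKr.
  rewrite pb pd ascaleMr !mulrA -!eC -!mulrA -e_det da -(qm_bc qmL).
  rewrite !mulrBr !ascaleMr.
  have lin (t u : T) :
      (- Q^-1) ** t + (u - (Q - Q^-1) ** t) = u - Q ** t.
    by lin_solve R T; do ! split => //; field.
  exact: lin.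
have S0 := star_subalg0 S_alg.
elim=> {m} [s Ss|x x' _ [s Ss es] _ [t St et]|k x _ [s Ss es]|x v _ IHx].
- by exists s => //; rewrite S_coinv // Psi_tens (anti1 Q0 qmL eC e_det) mulr1.
- exists (s + t); first exact: star_subalgD.
  by rewrite (star_homD dl_hom) PsiD es et -tolocD.
- exists (k ** s); first exact: star_subalgZ.
  by rewrite (star_homZ dl_hom) PsiZ es -tolocZ.
rewrite !inE => /or4P[] /eqP->.
- exists 0 => //; rewrite (_ : x * y = Q ** (x * c)); last first.
    by rewrite ascaleMr ascaleA divff // ascale1.
  by rewrite (star_homZ dl_hom) PsiZ Pc ascale0.
- exact: Pa.
- by exists 0 => //; rewrite Pb.
- have [s Ss es] := IHx; exists (- s); first exact: star_subalgN.
  rewrite (_ : x * w^† = -1 ** (x * d)); last by rewrite ascaleN1 mulrN opprK.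
  by rewrite (star_homZ dl_hom) PsiZ Pd es -tolocZ ascaleN1.
Qed.

(** [Psi] is computed in two ways: coinvariance returns [r^n x] itself, while the span gives an
    element of [S]. Comparing the two in the localization costs a further power [r^k]. *)
Lemma coinv_rspan x n : dl x = x ⊗ 1 ->
  rspan S [:: y; w; y^†; w^†] (csa r ^+ n * x) ->
  exists m, S (csa r ^+ m * x).
Proof.
move=> dlx /dl_rspan[s Ss].
rewrite (star_homM dl_hom).2 S_coinv ?dlx; last exact: star_subalgX.
rewrite tensM mulr1 Psi_tens (anti1 Q0 qmL eC e_det) mulr1 => /toloc_eq[k].
rewrite mulrA -exprD => eq_x; exists (k + n)%N; rewrite eq_x.
by apply: star_subalgM => //; apply: star_subalgX.
Qed.

End Descent.

(** * Commutation relations in the sphere algebra *)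

Section QuaternionIdentities.
Variables (R : rcfType) (A : starAlgType R) (Q zeta : R[i]) (z1 z2 z3 z4 : A).
Hypotheses (zeta0 : zeta != 0) (QE : Q = zeta ^- 2).
Hypotheses (QC : conjc Q = Q) (zetaC : conjc zeta = zeta).
Hypotheses (h12 : quat_pair Q z1 z2) (h34 : quat_pair Q z3 z4).
Hypothesis hX : quat_cross Q zeta z1 z2 z3 z4.

Let Q0 : Q != 0. Proof. by rewrite QE invr_eq0 expf_neq0. Qed.

Let inj k (x y : A) : k != 0 -> x = k ** y -> y = k^-1 ** x.
Proof. by move=> k0 ->; rewrite ascaleA mulVf // ascale1. Qed.

Let starE k (x : A) : conjc k = k -> (k ** x)^† = k ** x^†.
Proof. by rewrite starZ => ->. Qed.

Let conjM (k l : R[i]) : conjc k = k -> conjc l = l -> conjc (k * l) = k * l.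
Proof. by move=> kC lC; rewrite (rmorphM (@conjc R)) /= kC lC. Qed.

Let conjB (k l : R[i]) : conjc k = k -> conjc l = l -> conjc (k - l) = k - l.
Proof. by move=> kC lC; rewrite (rmorphB (@conjc R)) /= kC lC. Qed.

Let conj1 : conjc (1 : R[i]) = 1.
Proof. exact: (rmorph1 (@conjc R)). Qed.

Let conjQ2 : conjc (Q ^- 2) = Q ^- 2.
Proof. by apply: conjcV; rewrite expr2 conjM. Qed.

Let zQ0 : zeta * Q != 0. Proof. by rewrite mulf_neq0. Qed.
Let zQC : conjc (zeta * Q) = zeta * Q. Proof. exact: conjM. Qed.
Let QVC : conjc (Q - Q^-1) = Q - Q^-1. Proof. exact/conjB/conjcV. Qed.
Let QV2C : conjc (1 - Q ^- 2) = 1 - Q ^- 2. Proof. exact: conjB. Qed.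

(** The cross relations are solved so as to move [z3], [z4] and their stars to the right of [z1],
    [z2] and theirs. Together with [w_rules] this brings every word into a normal order. *)
Let r31 : z3 * z1 = (zeta * Q)^-1 ** (z1 * z3).
Proof. exact: inj (qc_13 hX). Qed.
Let r31s : z3 * z1^† = zeta^-1 ** (z1^† * z3).
Proof. exact: inj (qc_1s3 hX). Qed.
Let r32 : z3 * z2 = (zeta * Q)^-1 ** (z2 * z3).
Proof. exact: inj (qc_23 hX). Qed.
Let r32s : z3 * z2^† = zeta^-1 ** (z2^† * z3).
Proof. exact: inj (qc_2s3 hX). Qed.
Let r3s1 : z3^† * z1 = zeta ** (z1 * z3^†).
Proof. by have := congr1 (@star R A) (qc_1s3 hX); rewrite starE // !starM !starK. Qed.
Let r3s1s : z3^† * z1^† = zeta * Q ** (z1^† * z3^†).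
Proof. by have := congr1 (@star R A) (qc_13 hX); rewrite starE // !starM. Qed.
Let r3s2 : z3^† * z2 = zeta ** (z2 * z3^†).
Proof. by have := congr1 (@star R A) (qc_2s3 hX); rewrite starE // !starM !starK. Qed.
Let r3s2s : z3^† * z2^† = zeta * Q ** (z2^† * z3^†).
Proof. by have := congr1 (@star R A) (qc_23 hX); rewrite starE // !starM. Qed.
Let r4s1s : z4^† * z1^† = (zeta * Q)^-1 ** (z1^† * z4^†).
Proof.
by apply: inj => //; have := congr1 (@star R A) (qc_41 hX); rewrite starE // !starM.
Qed.
Let r4s2s : z4^† * z2^† = (zeta * Q)^-1 ** (z2^† * z4^†).
Proof.
by apply: inj => //; have := congr1 (@star R A) (qc_42 hX); rewrite starE // !starM.
Qed.
Let r4s1 : z4^† * z1 = zeta^-1 ** (z1 * z4^† - (Q - Q^-1) ** (z2^† * z3)).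
Proof. exact: inj (qc_14s hX). Qed.
Let r4s2 : z4^† * z2 = zeta^-1 ** (z2 * z4^† + (1 - Q ^- 2) ** (z1^† * z3)).
Proof. exact: inj (qc_24s hX). Qed.
Let r41s : z4 * z1^† = zeta ** (z1^† * z4) + (Q - Q^-1) ** (z3^† * z2).
Proof.
have := congr1 (@star R A) (qc_14s hX).
by rewrite starD starN !starE // !starM !starK => <-; rewrite subrK.
Qed.
Let r42s : z4 * z2^† = zeta ** (z2^† * z4) - (1 - Q ^- 2) ** (z3^† * z1).
Proof.
have := congr1 (@star R A) (qc_24s hX).
by rewrite starD !starE // !starM !starK => <-; rewrite addrK.
Qed.

(** This form applies a rule to two adjacent letters inside a longer, right-nested word. *)
Let mulE (x y t : A) : x * y = t -> forall z, x * (y * z) = t * z.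
Proof. by move=> <- z; rewrite mulrA. Qed.

Let mulAr (x y z : A) : x * y * z = x * (y * z).
Proof. by rewrite mulrA. Qed.

(** On the two blocks this is [p_11] and [p_33]; [quat_x1] and [quat_x2] are [p_13] and [p_14], half
    of the generators [x_1] and [x_2]. *)
Definition quat_norm (y w : A) : A := Q ^- 2 ** (y * y^†) + w^† * w.
Definition quat_x1 : A := Q ^- 2 ** (z1 * z3^†) + z2^† * z4.
Definition quat_x2 : A := Q^-1 ** (z1 * z4^†) - z2^† * z3.

Let X := quat_x1.
Let Z := quat_x2.
Let XsE : X^† = Q ^- 2 ** (z3 * z1^†) + z4^† * z2.
Proof. by rewrite starD starE // !starM !starK. Qed.
Let ZsE : Z^† = Q^-1 ** (z4 * z1^†) - z3^† * z2.
Proof. by rewrite starD starN starE ?conjcV // !starM !starK. Qed.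

Let w_rules (y w : A) : quat_pair Q y w ->
  (w * y = Q ** (y * w)) * (w * y^† = Q ** (y^† * w)) *
  (w^† * y = Q^-1 ** (y * w^†)) * (w^† * y^† = Q^-1 ** (y^† * w^†)) *
  (y^† * y = y * y^†) * (w * w^† = w^† * w - (1 - Q ^- 2) ** (y * y^†)).
Proof.
move=> h; have [-> -> -> ->] := quat_pair_rev QC Q0 h; case: h => _ _ -> <-.
by rewrite subKr.
Qed.

Let expE := (@mulrDl A, @mulrDr A, @mulNr A, @mulrN A, @ascaleMl R A, @ascaleMr R A).
Let p12 := w_rules h12.
Let p34 := w_rules h34.
Let sE := (p12, p34, r31, r31s, r32, r32s, r3s1, r3s1s, r3s2, r3s2s, r4s1s, r4s2s,
  r4s1, r4s2, r41s, r42s, qc_41 hX, qc_42 hX).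
Let p12' := (mulE p12.1.1.1.1.1, mulE p12.1.1.1.1.2, mulE p12.1.1.1.2,
  mulE p12.1.1.2, mulE p12.1.2, mulE p12.2).
Let p34' := (mulE p34.1.1.1.1.1, mulE p34.1.1.1.1.2, mulE p34.1.1.1.2,
  mulE p34.1.1.2, mulE p34.1.2, mulE p34.2).
Let sE' := (p12', p34', (mulE r31, mulE r31s, mulE r32, mulE r32s,
  mulE r3s1, mulE r3s1s, mulE r3s2, mulE r3s2s, mulE r4s1s, mulE r4s2s,
  mulE r4s1, mulE r4s2, mulE r41s, mulE r42s, mulE (qc_41 hX),
  mulE (qc_42 hX))).

(* Rewriting produces products that only agree up to conversion of the ring
   structure of A, whereas lin_solve compares atoms syntactically. *)
Let m (x y : A) : A := x * y.
Let mE x y : x * y = m x y. Proof. by []. Qed.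

Ltac nf := rewrite ?XsE ?ZsE /X /Z /quat_x1 /quat_x2 /quat_norm
  !(expE, mulAr, sE, sE') !mE; lin_solve R A; rewrite ?QE; do ! split => //; field.

Lemma quat_norm_comm :
  [/\ quat_norm z1 z2 * z1 = z1 * quat_norm z1 z2,
      quat_norm z1 z2 * z2 = z2 * quat_norm z1 z2,
      quat_norm z1 z2 * z3 = z3 * quat_norm z1 z2 &
      quat_norm z1 z2 * z4 = z4 * quat_norm z1 z2].
Proof. by split; nf. Qed.

(** For the blocks [u1], [u2] of [u] one has [u1^† u1 = r1], so [u2 r1 = (u2 u1^†) u1]. Up to sign
    and powers of [zeta] the entries of [u2 u1^†] are [X], [X^†], [Z], [Z^†], and [r1] commutes to
    the left. *)
Lemma quat_norm12_mul :
  quat_norm z1 z2 * z3 = X^† * z1 - zeta ^- 5 ** (Z * z2) /\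
  quat_norm z1 z2 * z4 = zeta ^+ 2 ** (Z^† * z1) + zeta ** (X * z2).
Proof. by split; nf. Qed.

Lemma quat_norm34_mul :
  quat_norm z3 z4 * z1 = zeta ^+ 2 ** (X * z3) + zeta ^- 4 ** (Z * z4) /\
  quat_norm z3 z4 * z2 = zeta^-1 ** (X^† * z4) - zeta ** (Z^† * z3).
Proof. by split; nf. Qed.

Let P := [:: X; X^†; Z; Z^†].

Let swaps (V : seq A) v p := exists k p' v' k' p'' v'',
  [/\ p' \in P, p'' \in P, v' \in V, v'' \in V &
      v * p = k ** (p' * v') + k' ** (p'' * v'')].

Let swap1 k (V : seq A) v p : v * p = k ** (p * v) -> v \in V -> p \in P -> swaps V v p.
Proof.
move=> vp vV pP; exists k, p, v, 0, p, v; split=> //.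
by rewrite ascale0l addr0.
Qed.

Let V12 := [:: z1; z2; z1^†; z2^†].
Let V34 := [:: z3; z4; z3^†; z4^†].

(** All pairs commute up to a power of [zeta], except [z1] with [X^†], [z2] with [X], [z1^†] with
    [X] and [z2^†] with [X^†]. These need a second term, whose coefficient vanishes at
    [zeta = 1]. *)
Lemma quat_swap12 v p : v \in V12 -> p \in P -> swaps V12 v p.
Proof.
have PE : [/\ X \in P, X^† \in P, Z \in P & Z^† \in P].
  by rewrite !inE !eqxx !orbT.
have VE : [/\ z1 \in V12, z2 \in V12, z1^† \in V12 & z2^† \in V12].
  by rewrite !inE !eqxx !orbT.
have [PX PXs PZ PZs] := PE; have [V1 V2 V1s V2s] := VE.
rewrite {1}/V12 {1}/P !inE => /or4P[] /eqP-> /or4P[] /eqP->.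
- by apply: (@swap1 zeta^-1) => //; nf.
- exists zeta^-1, X^†, z1, (zeta ^- 2 * (1 - zeta ^- 4)), Z, z2; split=> //.
  by nf.
- by apply: (@swap1 zeta) => //; nf.
- by apply: (@swap1 zeta) => //; nf.
- exists zeta, X, z2, (zeta ^+ 2 - zeta ^- 2), Z^†, z1; split=> //.
  by nf.
- by apply: (@swap1 zeta) => //; nf.
- by apply: (@swap1 zeta^-1) => //; nf.
- by apply: (@swap1 zeta^-1) => //; nf.
- exists zeta, X, z1^†, (zeta ^- 4 - 1), Z^†, z2^†; split=> //.
  by nf.
- by apply: (@swap1 zeta) => //; nf.
- by apply: (@swap1 zeta^-1) => //; nf.
- by apply: (@swap1 zeta^-1) => //; nf.
- by apply: (@swap1 zeta^-1) => //; nf.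
- exists zeta^-1, X^†, z2^†, (zeta ^- 4 - 1), Z, z1^†; split=> //.
  by nf.
- by apply: (@swap1 zeta) => //; nf.
- by apply: (@swap1 zeta) => //; nf.
Qed.

Lemma quat_swap34 v p : v \in V34 -> p \in P -> swaps V34 v p.
Proof.
move=> vV pP; suff [k vp] : exists k, v * p = k ** (p * v) by apply: swap1 vp _ _.
move: vV pP; rewrite !inE => /or4P[] /eqP-> /or4P[] /eqP->.
(* The factor is [zeta] or its inverse, depending on the pair. *)
all: try by exists zeta; nf.
all: by exists zeta^-1; nf.
Qed.

End QuaternionIdentities.

(** * Stability of the span up to powers of the norm *)

Section Saturation.
Variables (R : rcfType) (A : starAlgType R) (S : set A) (V : seq A) (r : central_sa A).
Hypotheses (S_alg : star_subalg S) (Sr : S r).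

Lemma rspan_mull s x : S s -> rspan S V x -> rspan S V (s * x).
Proof.
move=> Ss; elim=> {x} [t St|x y _ IHx _ IHy|k x _ IHx|x v _ IHx vV].
- by apply: rspan_sub; apply: (star_subalgM S_alg).
- by rewrite mulrDr; apply: rspanD.
- by rewrite ascaleMr; apply: rspanZ.
- by rewrite mulrA; apply: rspanM.
Qed.

Lemma rstable_csaX n : rstable S V (csa r ^+ n).
Proof.
elim: n => [|n IHn]; first exact: rstable1.
rewrite exprS; apply: rstableM IHn => x xM.
by rewrite -csaC; apply: rspan_mull.
Qed.

(** Since [r] is central and itself stable, the powers needed for two elements can be collected in
    front of their sum or product; these elements thus form a subalgebra as well. *)
Definition rsaturated y := exists n, rstable S V (csa r ^+ n * y).

Lemma rstable_saturated y : rstable S V y -> rsaturated y.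
Proof. by move=> yM; exists 0%N; rewrite expr0 mul1r. Qed.

Lemma rsaturated_csa y : rstable S V (csa r * y) -> rsaturated y.
Proof. by move=> yM; exists 1%N; rewrite expr1. Qed.

Lemma rsaturatedD y z : rsaturated y -> rsaturated z -> rsaturated (y + z).
Proof.
move=> [k yM] [l zM]; exists (k + l)%N; rewrite mulrDr; apply: rstableD.
  by rewrite addnC exprD -mulrA; apply: rstableM yM; apply: rstable_csaX.
by rewrite exprD -mulrA; apply: rstableM zM; apply: rstable_csaX.
Qed.

Lemma rsaturatedZ k y : rsaturated y -> rsaturated (k ** y).
Proof. by case=> n yM; exists n; rewrite ascaleMr; apply: rstableZ. Qed.

Lemma rsaturatedM y z : rsaturated y -> rsaturated z -> rsaturated (y * z).
Proof.
move=> [k yM] [l zM]; exists (k + l)%N.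
rewrite exprD -mulrA (mulrA _ y) (csaXC r l y) -(mulrA y) mulrA.
exact: rstableM.
Qed.

End Saturation.

(* Since r1^n and r2^m generate the unit ideal. *)
Lemma star_subalg_glue (R : rcfType) (A : starAlgType R) (S : set A) (r1 r2 x : A) n m :
  star_subalg S -> S r1 -> S r2 -> r1 * r2 = r2 * r1 -> r1 + r2 = 1 ->
  S (r1 ^+ n * x) -> S (r2 ^+ m * x) -> S x.
Proof.
move=> S_alg S1 S2 r12 r1D2.
have S1X k : S (r1 ^+ k) by apply: star_subalgX.
(* One factor [r1] is stripped at a time; the power of [r2] is lowered by
   [r2^k y = r1 r2^k y + r2^(k+1) y]. *)
have glue1 k y : S (r1 * y) -> S (r2 ^+ k * y) -> S y.
  move=> S1y; elim: k => [|k IHk]; first by rewrite expr0 mul1r.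
  rewrite exprS -mulrA => S2y; apply: IHk.
  rewrite -[_ * y]mul1r -r1D2 mulrDl; apply: star_subalgD => //.
  rewrite mulrA (commrX k r12 : r1 * _ = _) -mulrA.
  by apply: (star_subalgM S_alg) => //; apply: star_subalgX.
elim: n => [|n IHn]; first by rewrite expr0 mul1r.
rewrite exprS -mulrA => S1x S2x; apply: IHn => //; apply: (glue1 m) => //.
rewrite mulrA; have -> : r2 ^+ m * r1 ^+ n = r1 ^+ n * r2 ^+ m.
  by apply/esym/commrX/commr_sym/commrX.
by rewrite -mulrA; apply: (star_subalgM S_alg).
Qed.

(** [P] is not assumed stable under the star, so the induction on terms carries each value together
    with its star. *)
Lemma presented_ind (R : rcfType) (G : Type) (rel : sterm R G -> sterm R G -> Prop)
    (P : presented rel -> Prop) :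
  P 1 -> (forall x y, P x -> P y -> P (x + y)) -> (forall x y, P x -> P y -> P (x * y)) ->
  (forall c x, P x -> P (c ** x)) ->
  (forall g, P (pgen rel g) /\ P (pgen rel g)^†) -> forall x, P x.
Proof.
move=> P1 PD PM PZ Pg; elim/quotW=> t; rewrite -seval_pgen.
have P0 : P 0 by rewrite -(ascale0l 1); apply: PZ.
suff [] : P (seval (pgen rel) t) /\ P (seval (pgen rel) t)^† by [].
elim: t => //= [|| s [? ?] t [? ?]|s [? ?] t [? ?]|c s [? ?]|s [? ?]].
- by rewrite star0.
- by rewrite star1.
- by rewrite starD; split; apply: PD.
- by rewrite starM; split; apply: PM.
- by rewrite starZ; split; apply: PZ.
- by rewrite starK.
Qed.

Lemma star_hom_coinv_alg (R : rcfType) (A B : starAlgType R) (f : A -> tensor A B) :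
  star_hom f -> star_subalg [set x | f x = x ⊗ 1].
Proof.
move=> hom; have [hom1 homM] := star_homM hom; split=> //=.
- by move=> c x y fx fy; rewrite (star_homL hom) fx fy tensDl tensZl.
- by move=> x y fx fy; rewrite homM fx fy tensM mulr1.
- by move=> x fx; rewrite (star_homS hom) fx tensS star1.
Qed.

Lemma star_subalg_smallest (R : rcfType) (A : starAlgType R) (G : set A) :
  star_subalg (smallest (@star_subalg R A) G).
Proof.
split=> [|c x y Sx Sy|x y Sx Sy|x Sx] T [T_alg GT].
- exact: star_subalg1.
- by apply: star_subalgL => //; [exact: Sx | exact: Sy].
- by apply: (star_subalgM T_alg); [exact: Sx | exact: Sy].
- by apply: (star_subalgS T_alg); exact: Sx.
Qed.

(** Letters of [V] are stable outright; any other generator becomes a combination of products [p v]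
    after one factor [r], and both factors are stable. *)
Lemma presented_rsaturated (R : rcfType) (G : Type)
    (rel : sterm R G -> sterm R G -> Prop) (S : set (presented rel))
    (V P : seq (presented rel)) (r : central_sa (presented rel)) :
  star_subalg S -> S (csa r) -> (forall p, p \in P -> S p) ->
  (forall v p, v \in V -> p \in P -> exists k p' v' k' p'' v'',
    [/\ p' \in P, p'' \in P, v' \in V, v'' \in V &
        v * p = k ** (p' * v') + k' ** (p'' * v'')]) ->
  (forall p, p \in P -> p^† \in P) -> (forall v, v \in V -> v^† \in V) ->
  (forall g, pgen rel g \in V \/ exists k p v k' p' v',
    [/\ p \in P, p' \in P, v \in V, v' \in V &
        csa r * pgen rel g = k ** (p * v) + k' ** (p' * v')]) ->
  forall y, rsaturated S V r y.
Proof.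
move=> S_alg Sr PS swap Pstar Vstar gens.
have stP p : p \in P -> rstable S V p by apply: rstable_swap.
have stV v : v \in V -> rstable S V v by apply: rstableV.
apply: presented_ind.
- exact/rstable_saturated/rstable1.
- by move=> x y; apply: rsaturatedD.
- by move=> x y; apply: rsaturatedM.
- by move=> c x; apply: rsaturatedZ.
move=> g; case: (gens g) => [gV|[k [p [v [k' [p' [v' [pP p'P vV v'V rg]]]]]]]].
  by split; apply/rstable_saturated/stV => //; apply: Vstar.
split; apply: rsaturated_csa.
  by rewrite rg; apply: rstableD; apply: rstableZ; apply: rstableM; auto.
(* As [r] is self-adjoint, the star of the relation for [r g] settles the starred generator, with
   products [v^† p^†]. *)
rewrite csaC -{1}csaS -starM rg starD !starZ !starM.
by apply: rstableD; apply: rstableZ; apply: rstableM; auto.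
Qed.

Lemma presented_central (R : rcfType) (G : Type)
    (rel : sterm R G -> sterm R G -> Prop) (r : presented rel) :
  r^† = r -> (forall g, r * pgen rel g = pgen rel g * r) -> forall x, r * x = x * r.
Proof.
move=> rS rC; apply: presented_ind => [|x y xC yC|x y xC yC|c x xC|g].
- by rewrite mulr1 mul1r.
- by rewrite mulrDr mulrDl xC yC.
- by rewrite mulrA xC -mulrA yC mulrA.
- by rewrite ascaleMr xC ascaleMl.
by split=> //; rewrite -{1}rS -{2}rS -!starM rC.
Qed.

Lemma central_complement (A : pzRingType) (r s : A) :
  r + s = 1 -> (forall x, r * x = x * r) -> forall x, s * x = x * s.
Proof.
move=> rs rC x; have -> : s = 1 - r by rewrite -rs addrC addKr.
by rewrite mulrBl mulrBr mul1r mulr1 rC.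
Qed.

(** * The coinvariants of the sphere algebra *)

Section S4qCoinvariants.
Variables (R : rcfType) (q : R).
Hypothesis q_gt0 : 0 < q.
Let Q : R[i] := q%:C.
Let zeta : R[i] := ((Num.sqrt q)^-1)%:C.
Let A := S7q q.
Let B := SUq2 q.
Let z (g : quat_gen) : A := pgen (S7q_rel q) g.
Let g (x : suq_gen) : B := pgen (SUq2_rel q) x.

Let zetaE : zeta = (Num.sqrt q)%:C^-1.
Proof. by rewrite /zeta (fmorphV (real_complex R)). Qed.
Let zeta0 : zeta != 0.
Proof. by rewrite zetaE invr_eq0 (fmorph_eq0 (real_complex R)) gt_eqF ?sqrtr_gt0. Qed.
Let QE : Q = zeta ^- 2.
Proof.
by rewrite zetaE exprVn invrK -(rmorphXn (real_complex R)) /= sqr_sqrtr ?ltW.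
Qed.
Let QC : conjc Q = Q. Proof. by rewrite /Q /= oppr0. Qed.
Let zetaC : conjc zeta = zeta. Proof. by rewrite /zeta /= oppr0. Qed.
Let Q0 : Q != 0. Proof. by rewrite QE invr_eq0 expf_neq0. Qed.

Let rels s t : S7q_rel q s t ->
  seval (pgen (S7q_rel q)) s = seval (pgen (S7q_rel q)) t.
Proof. exact: pgen_rel. Qed.

Let pair g1 g2 :
  (forall s t, quat_rel q (SGen g1) (SGen g2) s t -> H2q_rel q s t) ->
  quat_pair Q (z g1) (z g2).
Proof.
move=> sub; split.
- exact: (rels (S7q_H2q (sub _ _ (quat_yw _ _ _)))).
- exact: (rels (S7q_H2q (sub _ _ (quat_yws _ _ _)))).
- exact: (rels (S7q_H2q (sub _ _ (quat_yys _ _ _)))).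
- by have := rels (S7q_H2q (sub _ _ (quat_wws _ _ _))); rewrite /= ascaleN1.
Qed.

Let h12 : quat_pair Q (z Z1) (z Z2). Proof. exact/pair/H2q_12. Qed.
Let h34 : quat_pair Q (z Z3) (z Z4). Proof. exact/pair/H2q_34. Qed.

Let hX : quat_cross Q zeta (z Z1) (z Z2) (z Z3) (z Z4).
Proof.
split.
- exact: (rels (S7q_H2q (H2q_13 q))).
- exact: (rels (S7q_H2q (H2q_1s3 q))).
- exact: (rels (S7q_H2q (H2q_23 q))).
- exact: (rels (S7q_H2q (H2q_2s3 q))).
- exact: (rels (S7q_H2q (H2q_41 q))).
- by have := rels (S7q_H2q (H2q_14s q)); rewrite /= ascaleN1.
- exact: (rels (S7q_H2q (H2q_42 q))).
- exact: (rels (S7q_H2q (H2q_24s q))).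
Qed.

Let r1 : A := quat_norm Q (z Z1) (z Z2).
Let r2 : A := quat_norm Q (z Z3) (z Z4).
Let X : A := quat_x1 Q (z Z1) (z Z2) (z Z3) (z Z4).
Let Z : A := quat_x2 Q (z Z1) (z Z2) (z Z3) (z Z4).

Let r1D2 : r1 + r2 = 1.
Proof. by have := rels (S7q_sphere q); rewrite /= -!addrA. Qed.

Let conjQ2 : conjc (Q ^- 2) = Q ^- 2.
Proof.
rewrite -exprVn; apply: etrans (rmorphXn (@conjc R) 2 Q^-1) _; congr (_ ^+ 2).
exact: conjcV.
Qed.

Let normS (y w : A) : (quat_norm Q y w)^† = quat_norm Q y w.
Proof. by rewrite starD starZ !starM !starK conjQ2. Qed.

Let r1C x : r1 * x = x * r1.
Proof.
have [z1C z2C z3C z4C] := quat_norm_comm zeta0 QE QC zetaC h12 hX.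
by apply: presented_central x; [exact: normS | case].
Qed.

(* The relations of H^2_q alone do not make r2 commute with z1. *)
Let r2C : forall x, r2 * x = x * r2.
Proof. exact: central_complement r1D2 r1C. Qed.

Let c1 := CentralSa r1C (normS _ _).
Let c2 := CentralSa r2C (normS _ _).

Let S := @S4q R q.

Let S_alg : star_subalg S.
Proof. exact: star_subalg_smallest. Qed.

Let Sp i j : S (S7q_p q i j).
Proof. by apply: sub_gen_smallest; exists i, j. Qed.

Let p_E : [/\ S r1, S r2, S X & S Z].
Proof.
split.
- have := Sp (inord 0) (inord 0).
  rewrite !mxE !big_ord_recl big_ord0 !mxE /= !inordK //=.
  rewrite starZ starN starK mulrNN addr0 ascaleMl ascaleMr ascaleA (conjcV QC).
  by rewrite -expr2 exprVn.
- have := Sp (inord 2) (inord 2).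
  rewrite !mxE !big_ord_recl big_ord0 !mxE /= !inordK //=.
  rewrite starZ starN starK mulrNN addr0 ascaleMl ascaleMr ascaleA (conjcV QC).
  by rewrite -expr2 exprVn.
- have := Sp (inord 0) (inord 2).
  rewrite !mxE !big_ord_recl big_ord0 !mxE /= !inordK //=.
  rewrite starZ starN starK mulrNN addr0 ascaleMl ascaleMr ascaleA (conjcV QC).
  by rewrite -expr2 exprVn.
- have := Sp (inord 0) (inord 3).
  rewrite !mxE !big_ord_recl big_ord0 !mxE /= !inordK //=.
  by rewrite starK mulNr addr0 ascaleMl.
Qed.

Let dl : A -> tensor A B := @S7q_deltaR R q.
Let hom : star_hom dl. Proof. exact: S7q_deltaR_star_hom. Qed.

Let suq s t : SUq2_rel q s t ->
  seval (pgen (SUq2_rel q)) s = seval (pgen (SUq2_rel q)) t.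
Proof. exact: pgen_rel. Qed.

(** This and the next three identities say that the matrix [(a, b; c, d)] times its adjoint is
    [1]. *)
Let aa : g SUa * (g SUa)^† + g SUb * (g SUb)^† = 1.
Proof.
rewrite [(g SUa)^†](suq (SUq2_as q)) [(g SUb)^†](suq (SUq2_bs q)) /= ascaleMr.
by have := suq (SUq2_det q); rewrite /= ascaleA mulN1r.
Qed.
Let ac : g SUa * (g SUc)^† + g SUb * (g SUd)^† = 0.
Proof.
rewrite [(g SUc)^†](suq (SUq2_cs q)) [(g SUd)^†](suq (SUq2_ds q)) /= ascaleMr.
by rewrite [g SUa * _](suq (SUq2_ab q)) /= ascaleA mulNr mulVf // ascaleN1 addNr.
Qed.
Let ca : g SUc * (g SUa)^† + g SUd * (g SUb)^† = 0.
Proof.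
rewrite [(g SUa)^†](suq (SUq2_as q)) [(g SUb)^†](suq (SUq2_bs q)) /= ascaleMr.
by rewrite [g SUc * _](suq (SUq2_cd q)) /= -ascaleDl addrN ascale0l.
Qed.
Let cc : g SUc * (g SUc)^† + g SUd * (g SUd)^† = 1.
Proof.
have da : g SUd * g SUa = g SUa * g SUd - (Q - Q^-1) ** (g SUb * g SUc).
  by have /= <- := suq (SUq2_ad q); rewrite ascaleN1 subKr.
have <- : g SUa * g SUd + (-1) ** (Q ** (g SUb * g SUc)) = 1.
  by have := suq (SUq2_det q).
rewrite [(g SUc)^†](suq (SUq2_cs q)) [(g SUd)^†](suq (SUq2_ds q)) /= ascaleMr da.
rewrite -[g SUc * _](suq (SUq2_bc q)) /=.
have lin (t u : B) : (- Q^-1) ** t + (u - (Q - Q^-1) ** t) = u + (-1) ** (Q ** t).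
  by lin_solve R B; do ! split => //; field.
exact: lin.
Qed.

(** The coaction multiplies rows on the right by a matrix [g] with [g g^† = 1], which cancels in
    [u g g^† v^†]. This makes the entries of [p] coinvariant. *)
Let coinv_uu (u0 u1 v0 v1 : A) :
  (u0 ⊗ g SUa + u1 ⊗ g SUc) * (v0 ⊗ g SUa + v1 ⊗ g SUc)^† +
  (u0 ⊗ g SUb + u1 ⊗ g SUd) * (v0 ⊗ g SUb + v1 ⊗ g SUd)^† =
  (u0 * v0^† + u1 * v1^†) ⊗ 1.
Proof.
have tens0 (x : A) : x ⊗ (0 : B) = 0 by rewrite -(ascale0l 0) tensZr ascale0l.
rewrite !starD !tensS !mulrDl !mulrDr !tensM addrACA [X in X + _]addrACA.
rewrite [X in _ + X]addrACA -!tensDr aa ac ca cc !tens0 addr0 add0r.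
by rewrite tensDl.
Qed.

Let uE i (k : 'I_2) := S7q_deltaR_u q_gt0 i k.

Let S_coinv x : S x -> dl x = x ⊗ 1.
Proof.
move: x; apply: (smallest_sub (star_hom_coinv_alg hom)) => x [i [j ->]] /=.
rewrite mxE; under eq_bigr => k do rewrite [_^T _ _]mxE [map_mx _ _ _ _]mxE.
rewrite !big_ord_recl big_ord0 addr0 (star_homD hom) !(star_homM hom).2.
rewrite !(star_homS hom) /dl !uE !big_ord_recl !big_ord0 !addr0.
by rewrite ![SUq2_mx _ _ _]mxE /=; apply: coinv_uu.
Qed.

Let memP p : p \in [:: X; X^†; Z; Z^†] -> S p.
Proof.
have [_ _ SX SZ] := p_E.
by rewrite !inE => /or4P[] /eqP->; try apply: (star_subalgS S_alg).
Qed.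

Let starP p : p \in [:: X; X^†; Z; Z^†] -> p^† \in [:: X; X^†; Z; Z^†].
Proof. by rewrite !inE => /or4P[] /eqP->; rewrite ?starK eqxx ?orbT. Qed.

Let starV (y w v : A) :
  v \in [:: y; w; y^†; w^†] -> v^† \in [:: y; w; y^†; w^†].
Proof. by rewrite !inE => /or4P[] /eqP->; rewrite ?starK eqxx ?orbT. Qed.

Let rspan_pow (V : seq A) (r : central_sa A) x : rsaturated S V r x ->
  exists n, rspan S V (csa r ^+ n * x).
Proof.
case=> n /(_ 1) H; exists n; rewrite -[_ * x]mul1r; apply: H.
by apply: rspan_sub; apply: (star_subalg1 S_alg).
Qed.

Let local1 x : dl x = x ⊗ 1 -> exists n, S (r1 ^+ n * x).
Proof.
have [Sr1 _ _ _] := p_E; have [e3 e4] := quat_norm12_mul zeta0 QE QC zetaC h12 hX.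
move=> dlx; have [] := @rspan_pow [:: z Z1; z Z2; (z Z1)^†; (z Z2)^†] c1 x.
  apply: (presented_rsaturated (P := [:: X; X^†; Z; Z^†])) => //.
  - exact: (quat_swap12 zeta0 QE QC zetaC h12 hX).
  - exact: starV.
  case; rewrite -/(z _).
  - by left; rewrite !inE eqxx.
  - by left; rewrite !inE eqxx orbT.
  - right; exists 1, X^†, (z Z1), (- zeta ^- 5), Z, (z Z2).
    by rewrite !inE !eqxx !orbT; split=> //; rewrite ascale1 ascaleNl.
  - right; exists (zeta ^+ 2), Z^†, (z Z1), zeta, X, (z Z2).
    by rewrite !inE !eqxx !orbT; split=> //.
move=> n; apply: (coinv_rspan (r := c1) Q0 hom S_alg S_coinv Sr1 h12 erefl _ _ _ _ dlx).
(* The second row of the block comes first, matching the exchange of rows in [coinv_rspan]. *)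
- have := uE (inord 1) ord0.
  by rewrite !big_ord_recl big_ord0 !mxE /= !inordK //= addr0.
- have := uE (inord 1) (lift ord0 ord0).
  by rewrite !big_ord_recl big_ord0 !mxE /= !inordK //= addr0.
- have := uE (inord 0) ord0.
  by rewrite !big_ord_recl big_ord0 !mxE /= !inordK //= addr0.
- have := uE (inord 0) (lift ord0 ord0).
  by rewrite !big_ord_recl big_ord0 !mxE /= !inordK //= addr0.
Qed.

Let local2 x : dl x = x ⊗ 1 -> exists n, S (r2 ^+ n * x).
Proof.
have [_ Sr2 _ _] := p_E; have [e1 e2] := quat_norm34_mul zeta0 QE QC zetaC h34 hX.
move=> dlx; have [] := @rspan_pow [:: z Z3; z Z4; (z Z3)^†; (z Z4)^†] c2 x.
  apply: (presented_rsaturated (P := [:: X; X^†; Z; Z^†])) => //.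
  - exact: (quat_swap34 zeta0 QE QC zetaC h34 hX).
  - exact: starV.
  case; rewrite -/(z _).
  - right; exists (zeta ^+ 2), X, (z Z3), (zeta ^- 4), Z, (z Z4).
    by rewrite !inE !eqxx !orbT; split=> //.
  - right; exists zeta^-1, X^†, (z Z4), (- zeta), Z^†, (z Z3).
    by rewrite !inE !eqxx !orbT; split=> //; rewrite ascaleNl.
  - by left; rewrite !inE eqxx.
  - by left; rewrite !inE eqxx orbT.
move=> n; apply: (coinv_rspan (r := c2) Q0 hom S_alg S_coinv Sr2 h34 erefl _ _ _ _ dlx).
- have := uE (inord 3) ord0.
  by rewrite !big_ord_recl big_ord0 !mxE /= !inordK //= addr0.
- have := uE (inord 3) (lift ord0 ord0).
  by rewrite !big_ord_recl big_ord0 !mxE /= !inordK //= addr0.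
- have := uE (inord 2) ord0.
  by rewrite !big_ord_recl big_ord0 !mxE /= !inordK //= addr0.
- have := uE (inord 2) (lift ord0 ord0).
  by rewrite !big_ord_recl big_ord0 !mxE /= !inordK //= addr0.
Qed.

Lemma S4q_coinv : @S4q R q = [set x | @S7q_deltaR R q x = x ⊗ 1].
Proof.
apply/seteqP; split=> x /=; first exact: S_coinv.
move=> dlx; have [n S1] := local1 dlx; have [m S2] := local2 dlx.
have [Sr1 Sr2 _ _] := p_E.
exact: (star_subalg_glue S_alg Sr1 Sr2 (r1C _) r1D2 S1 S2).
Qed.

End S4qCoinvariants.

Theorem proposition3p10 (R : realType) (q : R) (q_gt0 : 0 < q) (q_lt1 : q < 1) :
  S4q q = [set x : S7q q | S7q_deltaR x = x ⊗ 1].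
Proof. exact: S4q_coinv. Qed.
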